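(* Let $\Omega\subset\mathbb{R}^2$ be compact with non-empty interior. If $$h\ge 2\max\{|z-w|: z\in uf(\Omega),\ w\in\partial\Omega\},$$ then $\Omega$ has a unique solid angle center of height $h$.
   Context: $A_\Omega^{(h)}(x)=\int_\Omega \frac{h}{(|y-x|^2+h^2)^{3/2}}\,dy$; a solid angle center of height $h$ is a maximizer of $A_\Omega^{(h)}$ over $\mathbb{R}^2$. Minimal unfolded region: for $v\in S^1$ and $c\in\mathbb{R}$ let $I_{v,c}$ be the reflection in the line $\{z: z\cdot v=c\}$, $\Omega^+_{v,a}=\Omega\cap\{z\cdot v\ge a\}$, $\Omega^-_{v,a}=\Omega\cap\{z\cdot v\le a\}$, $u(v)=\inf\{b: I_{v,c}(\Omega^+_{v,c})\subset\Omega\ \forall c\ge b\}$, $l(v)=\sup\{b: I_{v,c}(\Omega^-_{v,c})\subset\Omega\ \forall c\le b\}$, and $uf(\Omega)=\bigcap_{v\in S^1}\{z\in\mathbb{R}^2: l(v)\le z\cdot v\le u(v)\}$. *)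

(* Defs.v *)
From Stdlib Require Import Reals Lra List ClassicalEpsilon.
Import ListNotations.
Open Scope R_scope.

Definition pt := (R * R)%type.
Definition dot (z w : pt) : R := fst z * fst w + snd z * snd w.
Definition sub (z w : pt) : pt := (fst z - fst w, snd z - snd w).
Definition dist2 (z w : pt) : R := sqrt (dot (sub z w) (sub z w)).

Definition ball2 (c : pt) (r : R) (p : pt) : Prop := dist2 p c < r.
Definition interior2 (S : pt -> Prop) (p : pt) : Prop :=
  exists r, 0 < r /\ forall q, ball2 p r q -> S q.
Definition closure2 (S : pt -> Prop) (p : pt) : Prop :=
  forall r, 0 < r -> exists q, ball2 p r q /\ S q.
Definition boundary2 (S : pt -> Prop) (p : pt) : Prop :=
  closure2 S p /\ ~ interior2 S p.
Definition is_open (S : pt -> Prop) : Prop := forall p, S p -> interior2 S p.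
Definition is_closed (S : pt -> Prop) : Prop := is_open (fun p => ~ S p).
Definition bounded (S : pt -> Prop) : Prop :=
  exists M, forall p, S p -> dist2 p (0,0) <= M.
(* Heine-Borel: compact subsets of R^2 = closed and bounded *)
Definition compact2 (S : pt -> Prop) : Prop := is_closed S /\ bounded S.

Definition is_glb (E : R -> Prop) (m : R) : Prop :=
  (forall x, E x -> m <= x) /\ (forall b, (forall x, E x -> b <= x) -> b <= m).
Definition Rinf (E : R -> Prop) : R :=
  epsilon (inhabits 0) (fun m => is_glb E m).
Definition Rsup (E : R -> Prop) : R :=
  epsilon (inhabits 0) (fun m => is_lub E m).

(* Integral over a compact set of a continuous nonnegative function, defined as the
   upper Darboux (outer Jordan) integral of f * 1_S: the infimum of the upper sums
   sum_i area(R_i) * c_i over finite covers of S by closed axis-parallel rectangles R_i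
   with f <= c_i on R_i.  For S compact and f continuous, nonnegative this coincides
   with the Lebesgue integral  int_S f(y) dy. *)
Record rect := mkRect { rx1 : R; rx2 : R; ry1 : R; ry2 : R }.
Definition rect_ok (r : rect) : Prop := rx1 r <= rx2 r /\ ry1 r <= ry2 r.
Definition in_rect (r : rect) (p : pt) : Prop :=
  rx1 r <= fst p <= rx2 r /\ ry1 r <= snd p <= ry2 r.
Definition area (r : rect) : R := (rx2 r - rx1 r) * (ry2 r - ry1 r).
Definition upper_sum (l : list (rect * R)) : R :=
  fold_right (fun rc acc => area (fst rc) * snd rc + acc) 0 l.
Definition integral_over (S : pt -> Prop) (f : pt -> R) : R :=
  Rinf (fun s => exists l : list (rect * R),
          (forall rc, In rc l -> rect_ok (fst rc)) /\
          (forall p, S p -> exists rc, In rc l /\ in_rect (fst rc) p) /\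
          (forall rc, In rc l -> forall p, in_rect (fst rc) p -> f p <= snd rc) /\
          s = upper_sum l).

Definition solid_angle (Om : pt -> Prop) (h : R) (x : pt) : R :=
  integral_over Om (fun y => h / Rpower (dot (sub y x) (sub y x) + h ^ 2) (3 / 2)).

Definition solid_angle_center (Om : pt -> Prop) (h : R) (x : pt) : Prop :=
  forall y, solid_angle Om h y <= solid_angle Om h x.

Definition unit_vec (v : pt) : Prop := dot v v = 1.
Definition reflect (v : pt) (c : R) (z : pt) : pt :=
  (fst z - 2 * (dot z v - c) * fst v, snd z - 2 * (dot z v - c) * snd v).
Definition uval (Om : pt -> Prop) (v : pt) : R :=
  Rinf (fun b => forall c, c >= b ->
          forall z, Om z -> dot z v >= c -> Om (reflect v c z)).
Definition lval (Om : pt -> Prop) (v : pt) : R :=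
  Rsup (fun b => forall c, c <= b ->
          forall z, Om z -> dot z v <= c -> Om (reflect v c z)).
Definition uf (Om : pt -> Prop) (z : pt) : Prop :=
  forall v, unit_vec v -> lval Om v <= dot z v <= uval Om v.

(* Main.v *)
(** Write [A] for the solid angle function; its kernel decreases with the distance.

    Every maximizer [x] of [A] lies in the minimal unfolded region: if [dot x v] exceeded
    a level above which [Om] can be folded, reflect [x] in a line at a slightly smaller
    level [c] to get [x'].  The part of [Om] beyond the line is folded into the part on
    this side, where [x'] is the closer of the two points, and a ball of [Om] on this side
    is left uncovered, so [A x' > A x].  Since the farthest points of [Om] from [x] are
    boundary points, the hypothesis says that all of [Om] is within [h/2] of [x].

    On [0, h/2] the profile [r |-> h / (r^2 + h^2)^(3/2)] is strictly concave, so at the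
    midpoint of two distinct maximizers [A] would be larger than its maximum.

    For a nonnegative Lipschitz integrand the upper Darboux integral over a bounded set is
    a limit of grid sums, hence additive in the integrand; its invariance under reflections
    comes from the fact that a sheared rectangle can be covered by thin upright rectangles
    of nearly the same total area. *)

From Coquelicot Require Import Coquelicot.
From Stdlib Require Import Reals Lra Lia Psatz List ClassicalEpsilon.
Require Import Defs.
Import ListNotations.
Open Scope R_scope.

(** * Upper integrals as limits of grid sums *)

Definition lsum {A} (F : A -> R) (l : list A) : R :=
  fold_right (fun a acc => F a + acc) 0 l.

Lemma lsum_app {A} (F : A -> R) l1 l2 : lsum F (l1 ++ l2) = lsum F l1 + lsum F l2.
Proof. induction l1 as [|a l1 IH]; simpl; [|rewrite IH]; ring. Qed.

Lemma lsum_flat_map {A B} (F : B -> R) (g : A -> list B) l :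
  lsum F (flat_map g l) = lsum (fun a => lsum F (g a)) l.
Proof. induction l as [|a l IH]; simpl; [|rewrite lsum_app, IH]; ring. Qed.

Lemma lsum_map {A B} (F : B -> R) (g : A -> B) l :
  lsum F (map g l) = lsum (fun a => F (g a)) l.
Proof. induction l as [|a l IH]; simpl; [|rewrite IH]; ring. Qed.

Lemma lsum_le {A} (F G : A -> R) l :
  (forall a, In a l -> F a <= G a) -> lsum F l <= lsum G l.
Proof.
induction l as [|a l IH]; simpl; intros H; [lra|].
apply Rplus_le_compat; auto.
Qed.

Lemma lsum_ext {A} (F G : A -> R) l :
  (forall a, In a l -> F a = G a) -> lsum F l = lsum G l.
Proof. intros H; apply Rle_antisym; apply lsum_le; intros; rewrite H; auto; lra. Qed.

Lemma lsum_plus {A} (F G : A -> R) l :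
  lsum (fun a => F a + G a) l = lsum F l + lsum G l.
Proof. induction l as [|a l IH]; simpl; [|rewrite IH]; ring. Qed.

Lemma lsum_scal_l {A} (F : A -> R) k l : lsum (fun a => k * F a) l = k * lsum F l.
Proof. induction l as [|a l IH]; simpl; [|rewrite IH]; ring. Qed.

Lemma lsum_scal_r {A} (F : A -> R) k l : lsum (fun a => F a * k) l = lsum F l * k.
Proof. induction l as [|a l IH]; simpl; [|rewrite IH]; ring. Qed.

Lemma lsum_const {A} k (l : list A) : lsum (fun _ => k) l = INR (length l) * k.
Proof. induction l as [|a l IH]; [simpl; ring|]. cbn [length lsum fold_right]. rewrite S_INR.
  change (fold_right _ 0 l) with (lsum (fun _ : A => k) l). rewrite IH; ring. Qed.

Lemma lsum_ge0 {A} (F : A -> R) l : (forall a, In a l -> 0 <= F a) -> 0 <= lsum F l.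
Proof.
induction l as [|a l IH]; simpl; intros H; [lra|].
apply Rplus_le_le_0_compat; auto.
Qed.

Lemma lsum_ge_term {A} (F : A -> R) l a :
  (forall a, In a l -> 0 <= F a) -> In a l -> F a <= lsum F l.
Proof.
induction l as [|b l IH]; simpl; intros H Ha; [easy|].
destruct Ha as [->|Ha].
- assert (0 <= lsum F l) by (apply lsum_ge0; auto). lra.
- assert (F a <= lsum F l) by auto. assert (0 <= F b) by auto. lra.
Qed.

Lemma lsum_swap {A B} (F : A -> B -> R) l1 l2 :
  lsum (fun a => lsum (fun b => F a b) l2) l1 = lsum (fun b => lsum (fun a => F a b) l1) l2.
Proof.
induction l1 as [|a l1 IH]; simpl.
- symmetry. rewrite lsum_const; ring.
- rewrite IH, <- lsum_plus. reflexivity.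
Qed.

Lemma lsum_telescope (u : nat -> R) n :
  lsum (fun i => u (S i) - u i) (seq 0 n) = u n - u 0%nat.
Proof.
induction n as [|n IH]; [simpl; ring|].
rewrite seq_S, lsum_app, IH. simpl. ring.
Qed.

(** * Covers by weighted rectangles *)

Definition l1dist (p q : pt) : R := Rabs (fst p - fst q) + Rabs (snd p - snd q).
Definition lip (L : R) (f : pt -> R) : Prop :=
  forall p q, Rabs (f p - f q) <= L * l1dist p q.
(** The class of integrands used throughout: on a cell of a fine grid such a function is nearly
    constant, which makes its upper integral a limit of grid sums. *)
Definition nnlip (f : pt -> R) : Prop :=
  (forall p, 0 <= f p) /\ exists L, 0 <= L /\ lip L f.

Definition in_box (M : R) (S : pt -> Prop) : Prop :=
  forall p, S p -> - M <= fst p <= M /\ - M <= snd p <= M.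

(* Unlike in [integral_over], [f p <= c] is only required at the points [p] for which
   the pair [(R, c)] is used; such covers are stable under maps of the plane. *)
Definition cover (S : pt -> Prop) (f : pt -> R) (l : list (rect * R)) : Prop :=
  (forall rc, In rc l -> rect_ok (fst rc) /\ 0 <= snd rc) /\
  forall p, S p -> exists rc, In rc l /\ in_rect (fst rc) p /\ f p <= snd rc.

(** A name for the set whose infimum defines [integral_over S f]. *)
Definition upper_sums (S : pt -> Prop) (f : pt -> R) (s : R) : Prop :=
  exists l : list (rect * R),
    (forall rc, In rc l -> rect_ok (fst rc)) /\
    (forall p, S p -> exists rc, In rc l /\ in_rect (fst rc) p) /\
    (forall rc, In rc l -> forall p, in_rect (fst rc) p -> f p <= snd rc) /\
    s = upper_sum l.

(** [epsilon] returns a greatest lower bound once one exists; completeness, applied to the set of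
    negatives, provides it. *)
Lemma Rinf_glb E : (exists x, E x) -> (exists m, forall x, E x -> m <= x) -> is_glb E (Rinf E).
Proof.
intros [x Hx] [m Hm]. unfold Rinf. apply epsilon_spec.
destruct (completeness (fun y => E (- y))) as [s [Hs1 Hs2]].
- exists (- m). intros y Hy. apply Hm in Hy. lra.
- exists (- x). now rewrite Ropp_involutive.
- exists (- s). split.
  + intros y Hy. enough (- y <= s) by lra. apply Hs1. now rewrite Ropp_involutive.
  + intros b Hb. enough (s <= - b) by lra. apply Hs2. intros y Hy. apply Hb in Hy. lra.
Qed.

Lemma Rsup_lub E : (exists x, E x) -> (exists m, forall x, E x -> x <= m) -> is_lub E (Rsup E).
Proof.
intros Hx [m Hm]. unfold Rsup. apply epsilon_spec.
destruct (completeness E) as [s Hs]; [exists m; exact Hm| exact Hx| now exists s].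
Qed.

Lemma area_ge0 r : rect_ok r -> 0 <= area r.
Proof. intros [H1 H2]. unfold area. apply Rmult_le_pos; lra. Qed.

(** The heights are nonnegative because a valid rectangle contains its lower left corner, where [f]
    is nonnegative and at most the height. *)
Lemma upper_sums_cover S f l : (forall p, 0 <= f p) ->
  (forall rc, In rc l -> rect_ok (fst rc)) ->
  (forall p, S p -> exists rc, In rc l /\ in_rect (fst rc) p) ->
  (forall rc, In rc l -> forall p, in_rect (fst rc) p -> f p <= snd rc) ->
  cover S f l.
Proof.
intros f0 H1 H2 H3. split.
- intros rc Hrc. split; [auto|]. destruct (H1 rc Hrc) as [A1 A2].
  apply Rle_trans with (f (rx1 (fst rc), ry1 (fst rc))); [apply f0|].
  apply (H3 rc Hrc). unfold in_rect; simpl; lra.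
- intros p Hp. destruct (H2 p Hp) as [rc [Hi Hr]]. exists rc; eauto.
Qed.

Lemma cover_sum_ge0 S f l : cover S f l -> 0 <= upper_sum l.
Proof.
intros [H _]. apply (lsum_ge0 (fun rc => area (fst rc) * snd rc)).
intros rc Hrc. destruct (H rc Hrc). apply Rmult_le_pos; [now apply area_ge0|auto].
Qed.

Lemma l1dist_ge0 p q : 0 <= l1dist p q.
Proof. unfold l1dist. generalize (Rabs_pos (fst p - fst q)) (Rabs_pos (snd p - snd q)). lra. Qed.

Lemma nnlip_box_bound f M : nnlip f -> 0 <= M ->
  exists c, 0 <= c /\ forall p, - M <= fst p <= M -> - M <= snd p <= M -> f p <= c.
Proof.
intros [f0 [L [L0 HL]]] HM. exists (f (0,0) + L * (2 * M)). split.
- generalize (f0 (0,0)). assert (0 <= L * (2 * M)) by nra. lra.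
- intros p H1 H2. generalize (HL p (0,0)) (Rle_abs (f p - f (0,0))). unfold l1dist; simpl.
  assert (Rabs (fst p - 0) <= M) by (apply Rabs_le; lra).
  assert (Rabs (snd p - 0) <= M) by (apply Rabs_le; lra).
  intros. assert (L * (Rabs (fst p - 0) + Rabs (snd p - 0)) <= L * (2 * M)) by nra. lra.
Qed.

Lemma integral_glb S f M : 0 <= M -> in_box M S -> nnlip f ->
  is_glb (upper_sums S f) (integral_over S f).
Proof.
intros HM HS Hf. apply Rinf_glb.
- destruct (nnlip_box_bound f M Hf HM) as [c [c0 Hc]].
  exists (upper_sum [(mkRect (-M) M (-M) M, c)]). exists [(mkRect (-M) M (-M) M, c)].
  repeat split; simpl.
  + destruct H as [<-|[]]; simpl; lra.
  + destruct H as [<-|[]]; simpl; lra.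
  + intros p Hp. eexists. split; [now left|]. apply (HS p Hp).
  + intros rc [<-|[]] p [H1 H2]; simpl in *. now apply Hc.
- exists 0. intros s [l [H1 [H2 [H3 ->]]]].
  apply cover_sum_ge0 with S f. apply upper_sums_cover; auto. apply Hf.
Qed.

(** * Grid sums *)

Definition node (M : R) (n i : nat) : R := - M + INR i * (2 * M / INR n).
Definition cell (M : R) (n i j : nat) : rect :=
  mkRect (node M n i) (node M n (S i)) (node M n j) (node M n (S j)).
Definition meets (S : pt -> Prop) (r : rect) : Prop := exists p, S p /\ in_rect r p.

(** The choice of cells depends on [S] alone and [f] is sampled at fixed corners, so the sum is
    linear in [f]. *)
Definition grid_sum (M : R) (n : nat) (S : pt -> Prop) (f : pt -> R) : R :=
  lsum (fun i => lsum (fun j =>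
    if excluded_middle_informative (meets S (cell M n i j))
    then area (cell M n i j) * f (node M n i, node M n j) else 0)
    (seq 0 n)) (seq 0 n).

Lemma node_S M n i : node M n (S i) = node M n i + 2 * M / INR n.
Proof. unfold node. rewrite S_INR. ring. Qed.

Lemma node_0 M n : node M n 0 = - M.
Proof. unfold node. simpl. ring. Qed.

Lemma node_n M n : (0 < n)%nat -> node M n n = M.
Proof. intros Hn. unfold node. field. apply not_0_INR. lia. Qed.

Lemma area_cell M n i j : area (cell M n i j) = (2 * M / INR n) * (2 * M / INR n).
Proof. unfold area, cell; simpl. rewrite !node_S. ring. Qed.

Lemma mesh_gt0 M n : 0 < M -> (0 < n)%nat -> 0 < 2 * M / INR n.
Proof. intros. apply Rdiv_lt_0_compat; [lra| now apply lt_0_INR]. Qed.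

Lemma subdivision_find a w n t : (0 < n)%nat -> a <= t <= a + INR n * w ->
  exists i, In i (seq 0 n) /\ a + INR i * w <= t <= a + INR (S i) * w.
Proof.
intros Hn Ht.
assert (H : forall k, t <= a + INR k * w -> (0 < k)%nat ->
   exists i, (i < k)%nat /\ a + INR i * w <= t <= a + INR (S i) * w).
{ induction k as [|k IH]; intros Hk k0; [lia|].
  destruct (Rle_or_lt (a + INR k * w) t) as [H|H]; [exists k; split; [lia|lra]|].
  destruct k as [|k]; [simpl in H; lra|].
  destruct IH as [i [Hi H']]; [lra|lia|]. exists i; split; [lia|auto]. }
destruct (H n) as [i [Hi Hi']]; [apply Ht|auto|].
exists i. split; [apply in_seq; lia|auto].
Qed.

Lemma node_find M n t : (0 < n)%nat -> - M <= t <= M ->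
  exists i, In i (seq 0 n) /\ node M n i <= t <= node M n (S i).
Proof.
intros Hn Ht. apply (subdivision_find (- M) (2 * M / INR n) n t Hn).
fold (node M n n). now rewrite node_n.
Qed.

Lemma lip_cell f L M n i j p : 0 < M -> (0 < n)%nat -> 0 <= L -> lip L f -> in_rect (cell M n i j) p ->
  Rabs (f p - f (node M n i, node M n j)) <= 2 * L * (2 * M / INR n).
Proof.
intros HM Hn L0 HL [H1 H2]. unfold cell in *; simpl in *. rewrite node_S in *.
eapply Rle_trans; [apply HL|]. unfold l1dist; simpl.
assert (Rabs (fst p - node M n i) <= 2 * M / INR n) by (apply Rabs_le; generalize (mesh_gt0 M n HM Hn); lra).
assert (Rabs (snd p - node M n j) <= 2 * M / INR n) by (apply Rabs_le; generalize (mesh_gt0 M n HM Hn); lra).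
nra.
Qed.

Lemma lsum_seq_const k n : lsum (fun _ => k) (seq 0 n) = INR n * k.
Proof. rewrite lsum_const, length_seq. reflexivity. Qed.

(** The cells meeting [S], each with its corner value raised by [2 L d] for the mesh [d], form an
    admissible cover. The box has area [4 M^2], which gives the error term. *)
Lemma integral_le_grid S f M L n : 0 < M -> in_box M S -> nnlip f -> 0 <= L -> lip L f -> (0 < n)%nat ->
  integral_over S f <= grid_sum M n S f + 8 * M * M * L * (2 * M / INR n).
Proof.
intros HM HS Hf L0 HL Hn. set (d := 2 * M / INR n). assert (d0 : 0 < d) by now apply mesh_gt0.
set (g := fun i j => if excluded_middle_informative (meets S (cell M n i j))
  then [(cell M n i j, f (node M n i, node M n j) + 2 * L * d)] else []).
set (l := flat_map (fun i => flat_map (g i) (seq 0 n)) (seq 0 n)).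
assert (Hl : forall rc, In rc l -> exists i j, rc = (cell M n i j, f (node M n i, node M n j) + 2 * L * d)).
{ intros rc H. apply in_flat_map in H. destruct H as [i [_ H]].
  apply in_flat_map in H. destruct H as [j [_ H]]. unfold g in H.
  destruct excluded_middle_informative; simpl in H; [|easy].
  destruct H as [<-|[]]. eauto. }
assert (H : integral_over S f <= upper_sum l).
{ apply (integral_glb S f M); auto; [lra|]. exists l. repeat split.
  - destruct (Hl rc H) as [i [j ->]]. simpl. rewrite node_S. fold d. lra.
  - destruct (Hl rc H) as [i [j ->]]. simpl. rewrite node_S. fold d. lra.
  - intros p Hp. destruct (HS p Hp) as [H1 H2].
    destruct (node_find M n (fst p) Hn H1) as [i [Hi Hi']].
    destruct (node_find M n (snd p) Hn H2) as [j [Hj Hj']].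
    exists (cell M n i j, f (node M n i, node M n j) + 2 * L * d). split; [|now split].
    apply in_flat_map. exists i; split; auto. apply in_flat_map. exists j; split; auto.
    unfold g. destruct excluded_middle_informative as [_|N]; [now left|].
    destruct N. exists p; split; [auto|now split].
  - intros rc H p Hp. destruct (Hl rc H) as [i [j ->]]. simpl in *.
    generalize (lip_cell f L M n i j p HM Hn L0 HL Hp). fold d.
    generalize (Rle_abs (f p - f (node M n i, node M n j))). lra. }
eapply Rle_trans; [exact H|]. clear H.
change (upper_sum l) with (lsum (fun rc => area (fst rc) * snd rc) l).
unfold l. rewrite lsum_flat_map.
replace (8 * M * M * L * d) with (lsum (fun _ => lsum (fun _ => d * d * (2 * L * d)) (seq 0 n)) (seq 0 n)).
2:{ rewrite !lsum_seq_const. unfold d. field. apply not_0_INR. lia. }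
unfold grid_sum. rewrite <- lsum_plus. apply lsum_le. intros i _.
rewrite lsum_flat_map, <- lsum_plus. apply lsum_le. intros j _.
assert (0 <= d * d * (2 * L * d)) by (apply Rmult_le_pos; nra).
unfold g. destruct excluded_middle_informative; cbn [lsum fold_right fst snd]; rewrite ?area_cell; fold d; lra.
Qed.

Definition clamp (a b t : R) : R := Rmax a (Rmin b t).

Lemma clamp_bounds a b t : a <= b -> a <= clamp a b t <= b.
Proof. intros H. unfold clamp, Rmax, Rmin. repeat destruct Rle_dec; lra. Qed.

Lemma clamp_incr a b s t : s <= t -> clamp a b s <= clamp a b t.
Proof. intros H. unfold clamp, Rmax, Rmin. repeat destruct Rle_dec; lra. Qed.

Lemma clamp_id a b t : a <= t <= b -> clamp a b t = t.
Proof. intros H. unfold clamp, Rmax, Rmin. repeat destruct Rle_dec; lra. Qed.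

(** A cell meeting [S] at [p] is charged to a pair of the cover that is used at [p]: the cell lies
    in that rectangle enlarged by the mesh on every side, and its corner value exceeds the height by
    at most [2 L d]. Exchanging the sums bounds the total charge of each pair. *)
Lemma grid_le_cover S f M L n l : 0 < M -> nnlip f -> 0 <= L -> lip L f -> (0 < n)%nat ->
  cover S f l ->
  grid_sum M n S f <= lsum (fun rc => (rx2 (fst rc) - rx1 (fst rc) + 2 * (2 * M / INR n)) *
     (ry2 (fst rc) - ry1 (fst rc) + 2 * (2 * M / INR n)) * (snd rc + 2 * L * (2 * M / INR n))) l.
Proof.
intros HM Hf L0 HL Hn [Hl1 Hl2]. set (d := 2 * M / INR n). assert (d0 : 0 < d) by now apply mesh_gt0.
(* [X] and [Y] are nonnegative, equal to the mesh over cells meeting the rectangle, and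
   telescope: they bound the number of cells meeting the rectangle. *)
set (X := fun (rc : rect * R) i => clamp (rx1 (fst rc) - d) (rx2 (fst rc) + d) (node M n (Datatypes.S i))
   - clamp (rx1 (fst rc) - d) (rx2 (fst rc) + d) (node M n i)).
set (Y := fun (rc : rect * R) i => clamp (ry1 (fst rc) - d) (ry2 (fst rc) + d) (node M n (Datatypes.S i))
   - clamp (ry1 (fst rc) - d) (ry2 (fst rc) + d) (node M n i)).
assert (X0 : forall rc i, 0 <= X rc i).
{ intros rc i. unfold X. rewrite node_S; fold d.
  assert (H := clamp_incr (rx1 (fst rc) - d) (rx2 (fst rc) + d) (node M n i) (node M n i + d)). lra. }
assert (Y0 : forall rc i, 0 <= Y rc i).
{ intros rc i. unfold Y. rewrite node_S; fold d.
  assert (H := clamp_incr (ry1 (fst rc) - d) (ry2 (fst rc) + d) (node M n i) (node M n i + d)). lra. }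
assert (C0 : forall rc, In rc l -> 0 <= snd rc + 2 * L * d).
{ intros rc Hrc. destruct (Hl1 rc Hrc). nra. }
apply Rle_trans with (lsum (fun i => lsum (fun j =>
  lsum (fun rc => X rc i * (Y rc j * (snd rc + 2 * L * d))) l) (seq 0 n)) (seq 0 n)).
- apply lsum_le; intros i _. apply lsum_le; intros j _.
  assert (P : forall rc, In rc l -> 0 <= X rc i * (Y rc j * (snd rc + 2 * L * d))).
  { intros rc Hrc. apply Rmult_le_pos; [apply X0|]. apply Rmult_le_pos; auto. }
  destruct excluded_middle_informative as [[p [Sp Hp]]|_]; [|now apply lsum_ge0].
  destruct (Hl2 p Sp) as [rc [Hrc [Hrp Hfp]]].
  eapply Rle_trans; [|apply (lsum_ge_term _ l rc P Hrc)].
  rewrite area_cell; fold d.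
  assert (E := lip_cell f L M n i j p HM Hn L0 HL Hp). fold d in E.
  assert (f (node M n i, node M n j) <= snd rc + 2 * L * d).
  { revert E. unfold Rabs. destruct Rcase_abs; lra. }
  destruct Hp as [Hp1 Hp2], Hrp as [Hr1 Hr2]. simpl in Hp1, Hp2. rewrite node_S in Hp1, Hp2. fold d in Hp1, Hp2.
  (* Both ends of the cell lie in the enlarged interval, so the clamps act as the identity and the
     increments equal the mesh. *)
  replace (X rc i) with d. replace (Y rc j) with d.
  + rewrite <- Rmult_assoc. apply Rmult_le_compat_l; [nra|auto].
  + unfold Y. rewrite node_S; fold d. rewrite !clamp_id; lra.
  + unfold X. rewrite node_S; fold d. rewrite !clamp_id; lra.
-
  rewrite (lsum_ext _ (fun i => lsum (fun rc => X rc i * lsum (fun j => Y rc j * (snd rc + 2 * L * d)) (seq 0 n)) l)).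
  2:{ intros i _. rewrite lsum_swap. apply lsum_ext. intros rc _. now rewrite lsum_scal_l. }
  rewrite lsum_swap. apply lsum_le. intros rc Hrc.
  rewrite lsum_scal_r, lsum_scal_r, <- Rmult_assoc.
  apply Rmult_le_compat_r; [auto|].
  destruct (Hl1 rc Hrc) as [[O1 O2] _].
  apply Rmult_le_compat; try (apply lsum_ge0; auto).
  + unfold X. rewrite (lsum_telescope (fun i => clamp (rx1 (fst rc) - d) (rx2 (fst rc) + d) (node M n i))).
    generalize (clamp_bounds (rx1 (fst rc) - d) (rx2 (fst rc) + d) (node M n n))
     (clamp_bounds (rx1 (fst rc) - d) (rx2 (fst rc) + d) (node M n 0)). lra.
  + unfold Y. rewrite (lsum_telescope (fun i => clamp (ry1 (fst rc) - d) (ry2 (fst rc) + d) (node M n i))).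
    generalize (clamp_bounds (ry1 (fst rc) - d) (ry2 (fst rc) + d) (node M n n))
     (clamp_bounds (ry1 (fst rc) - d) (ry2 (fst rc) + d) (node M n 0)). lra.
Qed.

Lemma enlarged_sum l L : (forall rc, In rc l -> rect_ok (fst rc) /\ 0 <= snd rc) -> 0 <= L ->
  exists K, 0 <= K /\ forall d, 0 < d <= 1 ->
    lsum (fun rc : rect * R => (rx2 (fst rc) - rx1 (fst rc) + 2 * d) *
     (ry2 (fst rc) - ry1 (fst rc) + 2 * d) * (snd rc + 2 * L * d)) l <= upper_sum l + K * d.
Proof.
intros Hl L0. induction l as [|rc l IH].
- exists 0. simpl. split; [lra|]. intros; lra.
- destruct IH as [K [K0 HK]]; [intros; apply Hl; now right|].
  destruct (Hl rc) as [[O1 O2] C0]; [now left|].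
  set (a := rx2 (fst rc) - rx1 (fst rc)). set (b := ry2 (fst rc) - ry1 (fst rc)). set (c := snd rc) in *.
  assert (0 <= a) by (unfold a; lra). assert (0 <= b) by (unfold b; lra).
  (* The product is a polynomial in [d] with nonnegative coefficients, so on [[0, 1]] it lies below
     its chord; the new summand is the slope of the chord. *)
  exists (K + ((a + 2) * (b + 2) * (c + 2 * L) - a * b * c)). split.
  + assert (0 <= a * b) by nra. assert (0 <= a * c) by nra. assert (0 <= b * c) by nra.
    assert (0 <= a * L) by nra. assert (0 <= b * L) by nra. assert (0 <= a * b * L) by nra. nra.
  + intros d Hd. specialize (HK d Hd).
    change (upper_sum (rc :: l)) with (a * b * c + upper_sum l).
    cbn [lsum fold_right]. fold a b c.
    assert ((a + 2 * d) * (b + 2 * d) * (c + 2 * L * d) <= a * b * c + ((a + 2) * (b + 2) * (c + 2 * L) - a * b * c) * d).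
    { assert (0 <= a * b) by nra. assert (0 <= a * c) by nra. assert (0 <= b * c) by nra.
      assert (0 <= a * L) by nra. assert (0 <= b * L) by nra. assert (0 <= a * b * L) by nra.
      assert (d * d <= d) by nra. assert (d * d * d <= d) by nra.
      enough (0 <= 4 * c * (d - d * d) + 4 * (a + b) * L * (d - d * d) + 8 * L * (d - d * d * d)) by lra.
      assert (0 <= c * (d - d * d)) by (apply Rmult_le_pos; lra).
      assert (0 <= (a * L + b * L) * (d - d * d)) by (apply Rmult_le_pos; lra).
      assert (0 <= L * (d - d * d * d)) by (apply Rmult_le_pos; lra). lra. }
    unfold lsum in HK. lra.
Qed.

Lemma mesh_small M e : 0 < M -> 0 < e -> exists n, (0 < n)%nat /\ 2 * M / INR n <= e.
Proof.
intros HM He. destruct (archimed_cor1 (e / (2 * M))) as [n [Hn n0]].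
- apply Rdiv_lt_0_compat; lra.
- exists n. split; auto. apply Rlt_le.
  apply Rmult_lt_compat_l with (r := 2 * M) in Hn; [|lra].
  replace (2 * M * (e / (2 * M))) with e in Hn by (field; lra). exact Hn.
Qed.

(** The weaker condition in [cover] still bounds the integral: a grid sum lies between the two sides
    up to an error proportional to the mesh. *)
Lemma integral_le_cover S f M l : 0 < M -> in_box M S -> nnlip f -> cover S f l ->
  integral_over S f <= upper_sum l.
Proof.
intros HM HS Hf Hl. destruct (proj2 Hf) as [L [L0 HL]].
destruct (enlarged_sum l L) as [K [K0 HK]]; [apply Hl|auto|].
apply Rnot_lt_le. intros N. set (e := integral_over S f - upper_sum l).
assert (C : 0 < K + 8 * M * M * L + 1).
{ assert (0 <= M * M * L) by (apply Rmult_le_pos; nra). nra. }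
destruct (mesh_small M (Rmin 1 (e / (2 * (K + 8 * M * M * L + 1)))) HM) as [n [n0 Hn]].
{ apply Rmin_glb_lt; [lra|]. apply Rdiv_lt_0_compat; unfold e; lra. }
assert (d0 := mesh_gt0 M n HM n0). set (d := 2 * M / INR n) in *.
assert (d1 : d <= 1) by (eapply Rle_trans; [exact Hn|apply Rmin_l]).
assert (d2 : d <= e / (2 * (K + 8 * M * M * L + 1))) by (eapply Rle_trans; [exact Hn|apply Rmin_r]).
assert (A := integral_le_grid S f M L n HM HS Hf L0 HL n0).
assert (B := grid_le_cover S f M L n l HM Hf L0 HL n0 Hl).
assert (D := HK d (conj d0 d1)). fold d in A, B.
assert (E : d * (2 * (K + 8 * M * M * L + 1)) <= e).
{ apply Rmult_le_compat_r with (r := 2 * (K + 8 * M * M * L + 1)) in d2; [|lra].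
  replace (e / (2 * (K + 8 * M * M * L + 1)) * (2 * (K + 8 * M * M * L + 1))) with e in d2 by (field; lra). exact d2. }
assert (e <= K * d + 8 * M * M * L * d) by (unfold e; lra).
assert (0 < (K + 8 * M * M * L + 1) * d) by nra. nra.
Qed.

Lemma cover_approx S f M e : 0 < M -> in_box M S -> nnlip f -> 0 < e ->
  exists l, cover S f l /\ upper_sum l < integral_over S f + e.
Proof.
intros HM HS Hf He.
destruct (integral_glb S f M) as [_ G]; auto; [lra|].
apply NNPP. intros N.
enough (integral_over S f + e <= integral_over S f) by lra.
apply G. intros s [l [H1 [H2 [H3 ->]]]]. apply Rnot_lt_le. intros H. apply N.
exists l. split; [|auto]. apply upper_sums_cover; auto. apply Hf.
Qed.

(** The estimate holds for every sufficiently fine grid, so that several integrands can share one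
    grid. *)
Lemma grid_limit S f M e : 0 < M -> in_box M S -> nnlip f -> 0 < e ->
  exists d, 0 < d /\ forall n, (0 < n)%nat -> 2 * M / INR n <= d ->
    Rabs (grid_sum M n S f - integral_over S f) <= e.
Proof.
intros HM HS Hf He. destruct (proj2 Hf) as [L [L0 HL]].
destruct (cover_approx S f M (e / 2) HM HS Hf) as [l [Hl Hs]]; [lra|].
destruct (enlarged_sum l L) as [K [K0 HK]]; [apply Hl|auto|].
assert (C0 : 0 <= 8 * M * M * L).
{ assert (0 <= M * M * L) by (apply Rmult_le_pos; nra). lra. }
set (Q := 2 * (K + 8 * M * M * L + 1)). assert (Q0 : 0 < Q) by (unfold Q; lra).
exists (Rmin 1 (e / Q)). split.
{ apply Rmin_glb_lt; [lra|]. now apply Rdiv_lt_0_compat. }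
intros n n0 Hn. assert (d0 := mesh_gt0 M n HM n0). set (d := 2 * M / INR n) in *.
assert (d1 : d <= 1) by (eapply Rle_trans; [exact Hn|apply Rmin_l]).
assert (d2 : d <= e / Q) by (eapply Rle_trans; [exact Hn|apply Rmin_r]).
assert (A := integral_le_grid S f M L n HM HS Hf L0 HL n0).
assert (B := grid_le_cover S f M L n l HM Hf L0 HL n0 Hl).
assert (D := HK d (conj d0 d1)). fold d in A, B.
assert (E : d * Q <= e).
{ apply Rmult_le_compat_r with (r := Q) in d2; [|lra].
  replace (e / Q * Q) with e in d2 by (field; lra). exact d2. }
unfold Q in E. assert (0 <= K * d) by nra. assert (0 <= 8 * M * M * L * d) by nra.
apply Rabs_le. lra.
Qed.

Lemma grid_sum_plus M n S f g :
  grid_sum M n S (fun p => f p + g p) = grid_sum M n S f + grid_sum M n S g.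
Proof.
unfold grid_sum. rewrite <- lsum_plus. apply lsum_ext; intros i _.
rewrite <- lsum_plus. apply lsum_ext; intros j _.
destruct excluded_middle_informative; ring.
Qed.

Lemma nnlip_plus f g : nnlip f -> nnlip g -> nnlip (fun p => f p + g p).
Proof.
intros [f0 [L [L0 HL]]] [g0 [L' [L0' HL']]]. split.
- intros p. generalize (f0 p) (g0 p). lra.
- exists (L + L'). split; [lra|]. intros p q. specialize (HL p q). specialize (HL' p q).
  replace (f p + g p - (f q + g q)) with ((f p - f q) + (g p - g q)) by ring.
  eapply Rle_trans; [apply Rabs_triang|]. lra.
Qed.

Lemma integral_plus S f g M : 0 < M -> in_box M S -> nnlip f -> nnlip g ->
  integral_over S (fun p => f p + g p) = integral_over S f + integral_over S g.
Proof.
intros HM HS Hf Hg.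
enough (H : forall e, 0 < e -> Rabs (integral_over S (fun p => f p + g p) - (integral_over S f + integral_over S g)) <= e).
{ apply Rminus_diag_uniq. apply NNPP. intros N. apply Rabs_pos_lt in N.
  specialize (H (Rabs (integral_over S (fun p => f p + g p) - (integral_over S f + integral_over S g)) / 2)). lra. }
intros e He.
destruct (grid_limit S f M (e / 3) HM HS Hf) as [d1 [d10 H1]]; [lra|].
destruct (grid_limit S g M (e / 3) HM HS Hg) as [d2 [d20 H2]]; [lra|].
destruct (grid_limit S _ M (e / 3) HM HS (nnlip_plus f g Hf Hg)) as [d3 [d30 H3]]; [lra|].
destruct (mesh_small M (Rmin d1 (Rmin d2 d3)) HM) as [n [n0 Hn]].
{ repeat apply Rmin_glb_lt; auto. }
generalize (Rmin_l d1 (Rmin d2 d3)) (Rmin_r d1 (Rmin d2 d3)) (Rmin_l d2 d3) (Rmin_r d2 d3). intros.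
specialize (H1 n n0). specialize (H2 n n0). specialize (H3 n n0). rewrite grid_sum_plus in H3.
assert (A1 : 2 * M / INR n <= d1) by lra. assert (A2 : 2 * M / INR n <= d2) by lra. assert (A3 : 2 * M / INR n <= d3) by lra.
apply H1 in A1. apply H2 in A2. apply H3 in A3.
revert A1 A2 A3. unfold Rabs. repeat destruct Rcase_abs; lra.
Qed.

(** * Area-contracting maps and monotonicity of the integral *)

(** [T] does not increase the outer Jordan content of rectangles. In this form the property passes
    to compositions. *)
Definition area_contracting (T : pt -> pt) : Prop := forall r e, rect_ok r -> 0 < e ->
  exists l, (forall r', In r' l -> rect_ok r') /\
    (forall p, in_rect r p -> exists r', In r' l /\ in_rect r' (T p)) /\
    lsum area l <= area r + e.

Lemma push_cover T l e : area_contracting T ->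
  (forall rc, In rc l -> rect_ok (fst rc) /\ 0 <= snd rc) -> 0 < e ->
  exists l' : list (rect * R),
    (forall rc, In rc l' -> rect_ok (fst rc) /\ 0 <= snd rc) /\
    (forall rc p, In rc l -> in_rect (fst rc) p ->
      exists rc', In rc' l' /\ in_rect (fst rc') (T p) /\ snd rc' = snd rc) /\
    upper_sum l' <= upper_sum l + e.
Proof.
intros HT. revert e. induction l as [|[r c] l IH]; intros e Hl He.
- exists []. simpl. repeat split; try easy; lra.
- destruct (IH (e / 2)) as [l' [A1 [A2 A3]]]; [intros; apply Hl; now right|lra|].
  destruct (Hl (r, c)) as [Hr c0]; [now left|]. simpl in Hr, c0.
  (* The excess area gets multiplied by the height [c]; dividing by [c + 1] keeps the cost below
     [e / 2], also for [c = 0]. *)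
  destruct (HT r (e / 2 / (c + 1)) Hr) as [l2 [B1 [B2 B3]]].
  { repeat apply Rdiv_lt_0_compat; lra. }
  exists (map (fun r' => (r', c)) l2 ++ l'). split; [|split].
  + intros rc H. apply in_app_or in H. destruct H as [H|H]; [|now apply A1].
    apply in_map_iff in H. destruct H as [r' [<- H]]. simpl. auto.
  + intros rc p [<-|Hrc] Hp.
    * destruct (B2 p Hp) as [r' [H1 H2]]. exists (r', c). split; [|now split].
      apply in_or_app. left. apply in_map_iff. eauto.
    * destruct (A2 rc p Hrc Hp) as [rc' [H1 H2]]. exists rc'. split; [|exact H2].
      apply in_or_app. now right.
  + change (upper_sum (?a ++ l')) with (lsum (fun rc => area (fst rc) * snd rc) (a ++ l')).
    change (upper_sum ((r, c) :: l)) with (area r * c + upper_sum l).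
    rewrite lsum_app, lsum_map. simpl. rewrite lsum_scal_r.
    change (lsum (fun rc => area (fst rc) * snd rc) l') with (upper_sum l').
    enough (lsum area l2 * c <= area r * c + e / 2) by lra.
    apply Rle_trans with ((area r + e / 2 / (c + 1)) * c); [now apply Rmult_le_compat_r|].
    assert (E : e / 2 / (c + 1) * (c + 1) = e / 2) by (field; lra).
    assert (0 < e / 2 / (c + 1)) by (repeat apply Rdiv_lt_0_compat; lra). lra.
Qed.

Lemma area_contracting_comp T1 T2 : area_contracting T1 -> area_contracting T2 ->
  area_contracting (fun p => T2 (T1 p)).
Proof.
intros H1 H2 r e Hr He.
destruct (H1 r (e / 2) Hr) as [l [A1 [A2 A3]]]; [lra|].
destruct (push_cover T2 (map (fun r' => (r', 1)) l) (e / 2) H2) as [l' [B1 [B2 B3]]].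
- intros rc H. apply in_map_iff in H. destruct H as [r' [<- H]]. simpl. split; [auto|lra].
- lra.
(* Every image point lies in a rectangle of height 1, and such a rectangle contributes exactly its
   area to the upper sum; the others are discarded. *)
- exists (map fst (filter (fun rc => if Req_dec_T (snd rc) 1 then true else false) l')). split; [|split].
  + intros r' H. apply in_map_iff in H. destruct H as [rc [<- H]]. apply filter_In in H. now apply B1.
  + intros p Hp. destruct (A2 p Hp) as [r' [C1 C2]].
    destruct (B2 (r', 1) (T1 p)) as [rc' [D1 [D2 D3]]]; [apply in_map_iff; eauto|auto|].
    exists (fst rc'). split; [|auto]. apply in_map_iff. exists rc'. split; [auto|]. apply filter_In.
    split; [auto|]. destruct Req_dec_T; [auto|now destruct n].
  + assert (E : upper_sum (map (fun r' => (r', 1)) l) = lsum area l).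
    { change (upper_sum ?x) with (lsum (fun rc => area (fst rc) * snd rc) x). rewrite lsum_map.
      apply lsum_ext. intros; simpl; ring. }
    rewrite E in B3.
    enough (lsum area (map fst (filter (fun rc => if Req_dec_T (snd rc) 1 then true else false) l')) <= upper_sum l') by lra.
    clear -B1. induction l' as [|rc l' IH]; [simpl; lra|].
    assert (IH' := IH (fun rc H => B1 rc (or_intror H))).
    change (upper_sum (rc :: l')) with (area (fst rc) * snd rc + upper_sum l').
    destruct (B1 rc) as [O C]; [now left|]. apply area_ge0 in O. simpl.
    destruct Req_dec_T as [E|N]; simpl.
    * rewrite E. lra.
    * assert (0 <= area (fst rc) * snd rc) by now apply Rmult_le_pos. lra.
Qed.

Lemma area_contracting_ext T T' : area_contracting T -> (forall p, T p = T' p) -> area_contracting T'.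
Proof.
intros H E r e Hr He. destruct (H r e Hr He) as [l [A1 [A2 A3]]]. exists l. split; [auto|split; [|auto]].
intros p Hp. rewrite <- E. auto.
Qed.

Lemma area_contracting_rect T :
  (forall r, rect_ok r -> exists r', rect_ok r' /\ area r' = area r /\
     forall p, in_rect r p -> in_rect r' (T p)) ->
  area_contracting T.
Proof.
intros H r e Hr He. destruct (H r Hr) as [r' [A1 [A2 A3]]]. exists [r']. split; [|split].
- intros ? [<-|[]]; auto.
- intros p Hp. exists r'. split; [now left|auto].
- simpl. lra.
Qed.

Lemma area_contracting_id : area_contracting (fun p => p).
Proof. apply area_contracting_rect. intros r Hr. exists r. auto. Qed.

Lemma area_contracting_neg : area_contracting (fun p => (- fst p, snd p)).
Proof.
apply area_contracting_rect. intros [a b c d] [H1 H2]. exists (mkRect (- b) (- a) c d).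
unfold rect_ok, area, in_rect in *; simpl in *. repeat split; lra.
Qed.

Lemma area_contracting_swap : area_contracting (fun p => (snd p, fst p)).
Proof.
apply area_contracting_rect. intros [a b c d] [H1 H2]. exists (mkRect c d a b).
unfold rect_ok, area, in_rect in *; simpl in *. repeat split; lra.
Qed.

Lemma area_contracting_translate s t : area_contracting (fun p => (fst p + s, snd p + t)).
Proof.
apply area_contracting_rect. intros [a b c d] [H1 H2]. exists (mkRect (a + s) (b + s) (c + t) (d + t)).
unfold rect_ok, area, in_rect in *; simpl in *. repeat split; lra.
Qed.

(** Cut the rectangle into [n] vertical strips of width [w]. The image of a strip fits into an
    upright rectangle taller by [2 |k| w], so the total excess is [2 |k| (b - a)^2 / n]. *)
Lemma area_contracting_shear k : area_contracting (fun p => (fst p, snd p + k * fst p)).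
Proof.
intros [a b c d] e [H1 H2] He. simpl in H1, H2.
set (K := Rabs k). assert (K0 : 0 <= K) by apply Rabs_pos.
destruct (archimed_cor1 (e / (2 * K * (b - a) * (b - a) + 1))) as [n [Hn n0]].
{ apply Rdiv_lt_0_compat; [auto|]. assert (0 <= K * ((b - a) * (b - a))) by (apply Rmult_le_pos; nra). lra. }
assert (N0 : 0 < INR n) by now apply lt_0_INR.
set (w := (b - a) / INR n). assert (w0 : 0 <= w).
{ unfold w, Rdiv. apply Rmult_le_pos; [lra|]. apply Rlt_le, Rinv_0_lt_compat; auto. }
exists (map (fun i => mkRect (a + INR i * w) (a + INR (S i) * w)
   (c + k * (a + INR i * w) - K * w) (d + k * (a + INR i * w) + K * w)) (seq 0 n)).
assert (Kw : 0 <= K * w) by now apply Rmult_le_pos.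
split; [|split].
- intros r H. apply in_map_iff in H. destruct H as [i [<- _]]. split; cbn [rx1 rx2 ry1 ry2].
  + rewrite S_INR. lra.
  + lra.
- intros p [P1 P2]. cbn [rx1 rx2 ry1 ry2] in P1, P2.
  destruct (subdivision_find a w n (fst p)) as [i [Hi Hi']]; [auto| |].
  { unfold w. replace (a + INR n * ((b - a) / INR n)) with b by (field; lra). lra. }
  eexists. split; [apply in_map_iff; exists i; split; [reflexivity|auto]|].
  split; cbn [rx1 rx2 ry1 ry2 fst snd]; [auto|].
  rewrite S_INR in Hi'.
  assert (B : Rabs (k * (fst p - (a + INR i * w))) <= K * w).
  { rewrite Rabs_mult. apply Rmult_le_compat_l; [auto|]. apply Rabs_le. lra. }
  revert B. unfold Rabs. destruct Rcase_abs; lra.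
- rewrite lsum_map.
  rewrite (lsum_ext _ (fun _ => w * (d - c + 2 * (K * w)))).
  2:{ intros i _. unfold area; cbn [rx1 rx2 ry1 ry2]. rewrite S_INR. ring. }
  rewrite lsum_seq_const. unfold area; cbn [rx1 rx2 ry1 ry2].
  assert (E : INR n * w = b - a) by (unfold w; field; lra).
  replace (INR n * (w * (d - c + 2 * (K * w)))) with ((INR n * w) * (d - c) + 2 * K * (INR n * w) * w) by ring.
  rewrite E. apply Rplus_le_compat_l.
  set (Q := 2 * K * (b - a) * (b - a)) in *.
  replace (2 * K * (b - a) * w) with (Q * / INR n) by (unfold Q, w; field; lra).
  assert (Q0 : 0 <= Q). { unfold Q. assert (0 <= K * ((b - a) * (b - a))) by (apply Rmult_le_pos; nra). lra. }
  apply Rle_trans with (Q * (e / (Q + 1))); [apply Rmult_le_compat_l; lra|].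
  assert (E2 : (Q + 1) * (e / (Q + 1)) = e) by (field; lra).
  assert (0 < e / (Q + 1)) by (apply Rdiv_lt_0_compat; lra). lra.
Qed.

(* A reflection is conjugate, by the shears [(x, y) -> (x + a y, y)] and
   [(x, y) -> (x, y + b x)], to [(x, y) -> (- x, y)]. *)
Lemma area_contracting_reflect v c : unit_vec v -> area_contracting (reflect v c).
Proof.
destruct v as [v1 v2]. unfold unit_vec, dot; simpl. intros Hv.
assert (sh : forall k, area_contracting (fun p => (fst p + k * snd p, snd p))).
{ intros k. apply (area_contracting_ext _ _ (area_contracting_comp _ _ (area_contracting_comp _ _
    area_contracting_swap (area_contracting_shear k)) area_contracting_swap)). reflexivity. }
destruct (Req_dec v1 0) as [->|N].
- apply (area_contracting_ext _ _ (area_contracting_comp _ _ (area_contracting_comp _ _ (area_contracting_comp _ _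
    area_contracting_swap area_contracting_neg) area_contracting_swap) (area_contracting_translate 0 (2 * c * v2)))).
  intros [x y]. unfold reflect, dot; simpl. f_equal; [ring|].
  replace (y - 2 * (x * 0 + y * v2 - c) * v2) with (y - 2 * y * (0 * 0 + v2 * v2) + 2 * c * v2) by ring.
  rewrite Hv. ring.
(* The mirror through the origin has direction [(a, 1)], and the shear by [- a] makes it vertical.
   The conjugated map fixes the vertical axis pointwise: it is the negation of [x] followed by a
   shear. *)
- set (a := - v2 / v1).
  apply (area_contracting_ext _ _ (area_contracting_comp _ _ (area_contracting_comp _ _ (area_contracting_comp _ _
    (area_contracting_comp _ _ (sh (- a)) area_contracting_neg) (area_contracting_shear (2 * (v1 * v2)))) (sh a))
    (area_contracting_translate (2 * c * v1) (2 * c * v2)))).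
  intros [x y]. unfold reflect, dot; simpl.
  assert (E : v1 * a = - v2) by (unfold a; field; auto).
  assert (E2 : v2 * v2 = 1 - v1 * v1) by lra.
  assert (E3 : y + 2 * (v1 * v2) * - (x + - a * y) = y - 2 * v1 * v2 * x - 2 * y * (v2 * v2)).
  { replace (y + 2 * (v1 * v2) * - (x + - a * y)) with (y - 2 * v1 * v2 * x + 2 * y * v2 * (v1 * a)) by ring.
    rewrite E. ring. }
  rewrite E3. f_equal; [|ring].
  apply (Rmult_eq_reg_l v1); [|auto].
  replace (v1 * (- (x + - a * y) + a * (y - 2 * v1 * v2 * x - 2 * y * (v2 * v2)) + 2 * c * v1)) with
    (- v1 * x + y * (v1 * a) + (v1 * a) * (y - 2 * v1 * v2 * x - 2 * y * (v2 * v2)) + 2 * c * v1 * v1) by ring.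
  rewrite E.
  replace (- v1 * x + y * - v2 + - v2 * (y - 2 * v1 * v2 * x - 2 * y * (v2 * v2)) + 2 * c * v1 * v1) with
    (- v1 * x + 2 * v1 * (v2 * v2) * x - 2 * y * v2 + 2 * y * v2 * (v2 * v2) + 2 * c * v1 * v1) by ring.
  rewrite E2. ring.
Qed.

(** A nearly optimal cover for [g] on [S] is pushed forward by [T]. Its heights control [f] only at
    the images of points where they controlled [g], which is what [cover] asks for. *)
Lemma integral_mono_map T S S' f g M : 0 < M -> in_box M S -> in_box M S' -> nnlip f -> nnlip g ->
  area_contracting T ->
  (forall q, S' q -> 0 < f q -> exists p, S p /\ T p = q /\ f q <= g p) ->
  integral_over S' f <= integral_over S g.
Proof.
intros HM HS HS' Hf Hg HT H. apply Rnot_lt_le. intros N.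
set (e := integral_over S' f - integral_over S g).
destruct (cover_approx S g M (e / 2) HM HS Hg) as [l [[Hl1 Hl2] Hs]]; [unfold e; lra|].
destruct (push_cover T l (e / 2) HT Hl1) as [l' [A1 [A2 A3]]]; [unfold e; lra|].
(* The zeros of [f] are covered at no cost by the whole box with height 0. *)
assert (C : cover S' f ((mkRect (-M) M (-M) M, 0) :: l')).
{ split.
  - intros rc [<-|Hrc]; [|auto]. unfold rect_ok; simpl; lra.
  - intros q Hq. destruct (Rle_or_lt (f q) 0) as [Q|Q].
    + eexists. split; [now left|]. split; [exact (HS' q Hq)|exact Q].
    + destruct (H q Hq Q) as [p [P1 [P2 P3]]]. destruct (Hl2 p P1) as [rc [R1 [R2 R3]]].
      destruct (A2 rc p R1 R2) as [rc' [B1 [B2 B3]]]. exists rc'. split; [now right|].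
      rewrite <- P2 at 1. split; [auto|]. rewrite B3. lra. }
assert (D := integral_le_cover S' f M _ HM HS' Hf C).
change (upper_sum ((mkRect (-M) M (-M) M, 0) :: l')) with (area (mkRect (-M) M (-M) M) * 0 + upper_sum l') in D.
unfold e in *. lra.
Qed.

Lemma integral_mono S S' f g M : 0 < M -> in_box M S -> in_box M S' -> nnlip f -> nnlip g ->
  (forall q, S' q -> 0 < f q -> S q /\ f q <= g q) ->
  integral_over S' f <= integral_over S g.
Proof.
intros HM HS HS' Hf Hg H. apply (integral_mono_map (fun p => p) S S' f g M); auto.
- apply area_contracting_id.
- intros q Sq Fq. destruct (H q Sq Fq). eauto.
Qed.

Lemma integral_ext S f g M : 0 < M -> in_box M S -> nnlip f -> nnlip g ->
  (forall q, S q -> f q = g q) -> integral_over S f = integral_over S g.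
Proof.
intros HM HS Hf Hg H. apply Rle_antisym; apply (integral_mono S S _ _ M); auto; intros q Sq _;
 (split; [auto|]); rewrite (H q Sq); apply Rle_refl.
Qed.

(** * Strict inequalities between integrals *)

Lemma clamp_step a b t d : a <= b -> 0 <= d ->
  0 <= clamp a b (t + d) - clamp a b t <= d /\
  (clamp a b (t + d) - clamp a b t = 0 \/ a - d <= t <= b).
Proof.
intros H1 H2. unfold clamp, Rmax, Rmin. repeat destruct Rle_dec; split; lra.
Qed.

(** On a square around [p0] the function is at least [k], and telescoping shows that the cells with
    lower left corner in it contribute at least [k s^2] to every fine grid sum. *)
Lemma integral_gt0 S f M p0 r k : 0 < M -> in_box M S -> nnlip f -> 0 < r -> 0 < k ->
  (forall q, l1dist q p0 < r -> S q /\ k <= f q) -> 0 < integral_over S f.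
Proof.
intros HM HS Hf Hr Hk H.
set (s := r / 3). assert (s0 : 0 < s) by (unfold s; lra).
assert (Sq : forall x y, Rabs (x - fst p0) <= s -> Rabs (y - snd p0) <= s -> S (x, y) /\ k <= f (x, y)).
{ intros x y Hx Hy. apply H. unfold l1dist; simpl. unfold s in *. lra. }
assert (B : forall u, Rabs (u + s - u) <= s) by (intros u; replace (u + s - u) with s by ring; rewrite Rabs_pos_eq; lra).
assert (B' : forall u, Rabs (u - s - u) <= s)
  by (intros u; replace (u - s - u) with (- s) by ring; rewrite Rabs_Ropp, Rabs_pos_eq; lra).
(* Two opposite corners of the square belong to [S], so the whole square lies in the box covered by
   the grid. *)
destruct (HS _ (proj1 (Sq _ _ (B _) (B _)))) as [U1 U2].
destruct (HS _ (proj1 (Sq _ _ (B' _) (B' _)))) as [V1 V2]. simpl in U1, U2, V1, V2.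
assert (K0 : 0 < k * s * s) by (apply Rmult_lt_0_compat; [apply Rmult_lt_0_compat|]; assumption).
destruct (grid_limit S f M (k * s * s / 2) HM HS Hf) as [d' [d'0 G]]; [lra|].
destruct (mesh_small M (Rmin d' (s / 2)) HM) as [n [n0 Hn]]; [apply Rmin_glb_lt; lra|].
generalize (Rmin_l d' (s / 2)) (Rmin_r d' (s / 2)). intros m1 m2.
specialize (G n n0 (Rle_trans _ _ _ Hn m1)).
assert (d0 := mesh_gt0 M n HM n0). set (d := 2 * M / INR n) in *.
enough (k * s * s <= grid_sum M n S f).
{ revert G. unfold Rabs. destruct Rcase_abs; lra. }
(* The interval is shortened by [d] at both ends: an increment is nonzero only if the node lies
   within [s] of [x], and since [d <= s / 2] the increments still add up to at least [s]. *)
set (X := fun x i => clamp (x - s + d) (x + s - d) (node M n (Datatypes.S i)) - clamp (x - s + d) (x + s - d) (node M n i)).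
assert (XS : forall x, - M <= x - s -> x + s <= M -> lsum (X x) (seq 0 n) >= s).
{ intros x X1 X2. unfold X. rewrite (lsum_telescope (fun i => clamp (x - s + d) (x + s - d) (node M n i))).
  rewrite node_n, node_0; auto. unfold clamp, Rmax, Rmin. repeat destruct Rle_dec; lra. }
apply Rle_trans with (lsum (fun i => lsum (fun j => X (fst p0) i * (k * X (snd p0) j)) (seq 0 n)) (seq 0 n)).
- rewrite (lsum_ext _ (fun i => X (fst p0) i * lsum (fun j => k * X (snd p0) j) (seq 0 n)))
    by (intros; apply lsum_scal_l).
  rewrite lsum_scal_r, lsum_scal_l.
  assert (X1 : s <= lsum (X (fst p0)) (seq 0 n)) by (apply Rge_le, XS; lra).
  assert (X2 : s <= lsum (X (snd p0)) (seq 0 n)) by (apply Rge_le, XS; lra).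
  replace (k * s * s) with (s * (k * s)) by ring.
  apply Rmult_le_compat; [lra|nra|exact X1|]. apply Rmult_le_compat_l; [lra|exact X2].
- apply lsum_le; intros i _. apply lsum_le; intros j _. unfold X.
  rewrite !node_S. fold d.
  destruct (clamp_step (fst p0 - s + d) (fst p0 + s - d) (node M n i) d) as [[x0 x1] xc]; [lra|lra|].
  destruct (clamp_step (snd p0 - s + d) (snd p0 + s - d) (node M n j) d) as [[y0 y1] yc]; [lra|lra|].
  set (x := clamp _ _ (node M n i + d) - _) in *. set (y := clamp _ _ (node M n j + d) - _) in *.
  assert (P : 0 <= (if excluded_middle_informative (meets S (cell M n i j))
     then area (cell M n i j) * f (node M n i, node M n j) else 0)).
  { destruct excluded_middle_informative; [|lra]. rewrite area_cell. fold d.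
    apply Rmult_le_pos; [nra|apply Hf]. }
  destruct xc as [E|Hx]; [rewrite E; lra|]. destruct yc as [E|Hy]; [rewrite E; lra|].
  destruct (Sq (node M n i) (node M n j)) as [S1 S2]; try (apply Rabs_le; lra).
  destruct excluded_middle_informative as [_|Nm].
  + rewrite area_cell. fold d.
    assert (x * y <= d * d) by (apply Rmult_le_compat; lra).
    assert (0 <= x * y) by now apply Rmult_le_pos.
    apply Rle_trans with (d * d * k); [nra|]. apply Rmult_le_compat_l; [nra|auto].
  + destruct Nm. eexists. split; [exact S1|]. unfold in_rect, cell; simpl. rewrite !node_S. fold d. lra.
Qed.

Lemma l1dist_triangle p q r : l1dist p r <= l1dist p q + l1dist q r.
Proof.
unfold l1dist. generalize (Rabs_triang (fst p - fst q) (fst q - fst r)) (Rabs_triang (snd p - snd q) (snd q - snd r)).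
replace (fst p - fst q + (fst q - fst r)) with (fst p - fst r) by ring.
replace (snd p - snd q + (snd q - snd r)) with (snd p - snd r) by ring. lra.
Qed.

Lemma l1dist_sym p q : l1dist p q = l1dist q p.
Proof. unfold l1dist. now rewrite (Rabs_minus_sym (fst p)), (Rabs_minus_sym (snd p)). Qed.

Lemma l1dist_refl p : l1dist p p = 0.
Proof. unfold l1dist. rewrite !Rminus_diag, Rabs_R0. ring. Qed.

Lemma Rmax0_lip a b : Rabs (Rmax 0 a - Rmax 0 b) <= Rabs (a - b).
Proof. unfold Rmax, Rabs. repeat destruct Rle_dec; repeat destruct Rcase_abs; lra. Qed.

(* Strictness is tested against the auxiliary [f0], which dominates [f] on the part of
   [S'] near [p0]; [f0 = 0] is allowed when [S'] does not come near [p0]. *)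
Lemma integral_lt S S' f g f0 M p0 r :
  0 < M -> in_box M S -> in_box M S' -> nnlip f -> nnlip g -> nnlip f0 -> 0 < r ->
  (forall q, l1dist q p0 < r -> S q) ->
  (forall q, S' q -> 0 < f q -> S q /\ f q <= g q) ->
  (forall q, S' q -> l1dist q p0 < r -> f q <= f0 q) ->
  f0 p0 < g p0 ->
  integral_over S' f < integral_over S g.
Proof.
intros HM HS HS' Hf Hg Hf0 Hr B1 B2 B3 B4.
destruct (proj2 Hg) as [L [L0 HL]]. destruct (proj2 Hf0) as [L' [L0' HL']].
set (K := L + L' + 1). assert (K0 : 0 < K) by (unfold K; lra).
set (e := Rmin (g p0 - f0 p0) (K * r)).
assert (e0 : 0 < e) by (apply Rmin_glb_lt; [lra|nra]).
assert (e1 : e <= g p0 - f0 p0) by apply Rmin_l. assert (e2 : e <= K * r) by apply Rmin_r.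
(* A tent of height [e] and slope [K] over [p0]. As [g - f0] is at least [e] at [p0] and falls with
   slope less than [K], the tent fits below it; it vanishes outside the ball of radius [r]. The
   proof compares [f] with [g - b]. *)
set (b := fun q => Rmax 0 (e - K * l1dist q p0)).
assert (Kb : lip K b).
{ intros p q. unfold b. eapply Rle_trans; [apply Rmax0_lip|].
  generalize (l1dist_triangle p q p0) (l1dist_triangle q p p0). rewrite (l1dist_sym q p). intros T1 T2.
  apply Rabs_le. nra. }
assert (b0 : forall q, 0 <= b q) by (intros q; apply Rmax_l).
assert (bg : forall q, b q = 0 \/ (l1dist q p0 < r /\ f0 q + b q <= g q)).
{ intros q. destruct (Rle_or_lt (e - K * l1dist q p0) 0) as [E|E].
  - left. unfold b. now rewrite Rmax_left.
  - right. unfold b. rewrite Rmax_right by lra. split; [nra|].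
    assert (G1 := HL q p0). assert (G2 := HL' q p0). assert (D := l1dist_ge0 q p0).
    apply Rcomplements.Rabs_le_between in G1. apply Rcomplements.Rabs_le_between in G2.
    unfold K. nra. }
assert (nb : nnlip b) by (split; [auto|]; exists K; split; [lra|auto]).
assert (ngb : nnlip (fun q => g q - b q)).
{ split.
  - intros q. generalize (proj1 Hg q) (proj1 Hf0 q). destruct (bg q) as [->|[_ H]]; lra.
  - exists (L + K). split; [lra|]. intros p q. specialize (HL p q). specialize (Kb p q).
    replace (g p - b p - (g q - b q)) with ((g p - g q) - (b p - b q)) by ring.
    unfold Rminus at 1. eapply Rle_trans; [apply Rabs_triang|]. rewrite Rabs_Ropp. lra. }
assert (P : 0 < integral_over S b).
{ apply (integral_gt0 S b M p0 (Rmin r (e / (2 * K))) (e / 2)); auto.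
  - apply Rmin_glb_lt; [auto|]. apply Rdiv_lt_0_compat; lra.
  - lra.
  - intros q Hq. assert (Q1 := Rmin_l r (e / (2 * K))). assert (Q2 := Rmin_r r (e / (2 * K))).
    split; [apply B1; lra|]. unfold b. apply Rle_trans with (e - K * l1dist q p0); [|apply Rmax_r].
    assert (K * l1dist q p0 <= K * (e / (2 * K))) by (apply Rmult_le_compat_l; lra).
    replace (K * (e / (2 * K))) with (e / 2) in H by (field; lra). lra. }
assert (E : integral_over S g = integral_over S (fun q => g q - b q) + integral_over S b).
{ rewrite <- (integral_plus S _ _ M); auto. apply (integral_ext S _ _ M); auto.
  - now apply nnlip_plus.
  - intros; ring. }
enough (integral_over S' f <= integral_over S (fun q => g q - b q)) by lra.
apply (integral_mono S S' _ _ M); auto.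
intros q Sq Fq. destruct (B2 q Sq Fq) as [Q1 Q2]. split; [auto|].
destruct (bg q) as [->|[H1 H2]]; [lra|]. specialize (B3 q Sq H1). lra.
Qed.

(** * Reflections and the unfolded region *)

Lemma dist2_triangle p q r : dist2 p r <= dist2 p q + dist2 q r.
Proof. exact (triangle (fst p) (snd p) (fst r) (snd r) (fst q) (snd q)). Qed.

Lemma dot_ge0 p : 0 <= dot p p.
Proof. unfold dot. nra. Qed.

Lemma dist2_ge0 p q : 0 <= dist2 p q.
Proof. apply sqrt_pos. Qed.

Lemma dist2_sq p q : dist2 p q * dist2 p q = dot (sub p q) (sub p q).
Proof. apply sqrt_sqrt, dot_ge0. Qed.

Lemma dist2_sym p q : dist2 p q = dist2 q p.
Proof. unfold dist2. f_equal. unfold dot, sub; simpl. ring. Qed.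

Lemma dist2_le_l1dist p q : dist2 p q <= l1dist p q.
Proof.
apply Rsqr_incr_0_var; [|apply l1dist_ge0]. unfold Rsqr. rewrite dist2_sq.
unfold l1dist, dot, sub; simpl.
generalize (Rabs_pos (fst p - fst q)) (Rabs_pos (snd p - snd q)).
generalize (Rsqr_abs (fst p - fst q)) (Rsqr_abs (snd p - snd q)). unfold Rsqr. intros -> ->. nra.
Qed.

Lemma unit_dot_le v p q : unit_vec v -> Rabs (dot p v - dot q v) <= dist2 p q.
Proof.
intros Hv. apply Rsqr_incr_0_var; [|apply dist2_ge0]. rewrite <- Rsqr_abs. unfold Rsqr. rewrite dist2_sq.
unfold unit_vec in Hv. rewrite <- (Rmult_1_r (dot (sub p q) _)), <- Hv.
(* Lagrange's identity: this square is the defect in the Cauchy-Schwarz inequality. *)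
assert (0 <= Rsqr ((fst p - fst q) * snd v - (snd p - snd q) * fst v)) by apply Rle_0_sqr.
unfold Rsqr, dot, sub in *; simpl. lra.
Qed.

Lemma coord_le_dist2 p q : Rabs (fst p - fst q) <= dist2 p q /\ Rabs (snd p - snd q) <= dist2 p q.
Proof.
split.
- generalize (unit_dot_le (1, 0) p q). unfold unit_vec, dot; simpl. rewrite !Rmult_1_r, !Rmult_0_r, !Rplus_0_r. intros H; apply H; ring.
- generalize (unit_dot_le (0, 1) p q). unfold unit_vec, dot; simpl. rewrite !Rmult_1_r, !Rmult_0_r, !Rplus_0_l. intros H; apply H; ring.
Qed.

Lemma bounded_in_box S : bounded S -> exists M, 0 < M /\ in_box M S.
Proof.
intros [M HM]. exists (Rabs M + 1). split; [generalize (Rabs_pos M); lra|].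
intros p Hp. specialize (HM p Hp). destruct (coord_le_dist2 p (0, 0)) as [A B]. simpl in A, B.
rewrite Rminus_0_r in A, B. generalize (Rle_abs M). intros C.
apply Rcomplements.Rabs_le_between in A. apply Rcomplements.Rabs_le_between in B. lra.
Qed.

Lemma in_box_mono M M' S : M <= M' -> in_box M S -> in_box M' S.
Proof. intros H HS p Hp. destruct (HS p Hp). lra. Qed.

Lemma in_box_dot M S v p : unit_vec v -> in_box M S -> S p -> Rabs (dot p v) <= 2 * M.
Proof.
intros Hv HS Hp. destruct (HS p Hp) as [A B].
generalize (unit_dot_le v p (0, 0) Hv) (dist2_le_l1dist p (0, 0)). unfold l1dist. simpl.
replace (dot p v - dot (0, 0) v) with (dot p v) by (unfold dot; simpl; ring).
assert (Rabs (fst p - 0) <= M) by (apply Rabs_le; lra).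
assert (Rabs (snd p - 0) <= M) by (apply Rabs_le; lra). lra.
Qed.

Lemma reflect_involutive v c z : unit_vec v -> reflect v c (reflect v c z) = z.
Proof.
unfold unit_vec. intros Hv. destruct v as [v1 v2], z as [x y]. unfold reflect, dot in *; simpl in *.
assert (E : (x - 2 * (x * v1 + y * v2 - c) * v1) * v1 + (y - 2 * (x * v1 + y * v2 - c) * v2) * v2 - c
  = (x * v1 + y * v2 - c) - 2 * (x * v1 + y * v2 - c) * (v1 * v1 + v2 * v2)) by ring.
rewrite E, Hv. f_equal; ring.
Qed.

Lemma dot_reflect v c z : unit_vec v -> dot (reflect v c z) v = 2 * c - dot z v.
Proof.
unfold unit_vec. intros Hv.
replace (dot (reflect v c z) v) with (dot z v - 2 * (dot z v - c) * dot v v) by (unfold reflect, dot; simpl; ring).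
rewrite Hv. ring.
Qed.

Lemma dist2_reflect v c z w : unit_vec v -> dist2 (reflect v c z) (reflect v c w) = dist2 z w.
Proof.
unfold unit_vec. intros Hv. unfold dist2. f_equal.
replace (dot (sub (reflect v c z) (reflect v c w)) (sub (reflect v c z) (reflect v c w))) with
 (dot (sub z w) (sub z w) + 4 * (dot z v - dot w v) * (dot z v - dot w v) * (dot v v - 1))
 by (unfold reflect, dot, sub; simpl; ring).
rewrite Hv. ring.
Qed.

(** The squared distances differ by [4 (dot x v - c) (c - dot q v)]. *)
Lemma dist2_reflect_lt v c x q : unit_vec v -> c < dot x v -> dot q v < c ->
  dist2 q (reflect v c x) < dist2 q x.
Proof.
unfold unit_vec. intros Hv H1 H2. apply sqrt_lt_1; try apply dot_ge0.
replace (dot (sub q (reflect v c x)) (sub q (reflect v c x))) with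
 (dot (sub q x) (sub q x) - 4 * ((dot x v - c) * (c - dot q v)) + 4 * (dot x v - c) * (dot x v - c) * (dot v v - 1))
 by (unfold reflect, dot, sub; simpl; ring).
rewrite Hv. assert (0 < (dot x v - c) * (c - dot q v)) by (apply Rmult_lt_0_compat; lra). lra.
Qed.

(** [uval Om v] is the infimum of these levels. *)
Definition foldable (Om : pt -> Prop) (v : pt) (b : R) : Prop :=
  forall c, c >= b -> forall z, Om z -> dot z v >= c -> Om (reflect v c z).

Definition shift (p v : pt) (t : R) : pt := (fst p + t * fst v, snd p + t * snd v).

(* If every point of the half-plane [dot q v < c] interior to [Om] were reflected into
   [Om], then composing the reflections at levels [c] and [b] would translate a small
   ball of [Om] by [- 2 (c - b) v] into [Om], again and again. *)
Lemma asymmetric_ball Om v b c : is_closed Om -> bounded Om -> (exists p, interior2 Om p) ->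
  unit_vec v -> foldable Om v b -> b < c ->
  exists p r, 0 < r /\ forall q, ball2 p r q -> Om q /\ dot q v < c /\ ~ Om (reflect v c q).
Proof.
intros Hc Hb [p0 [r0 [r00 Hp0]]] Hv Hf Hbc. apply NNPP. intros N.
set (P := fun p r => forall q, ball2 p r q -> Om q /\ dot q v < c).
(* [Om] is closed: if one point of the ball were reflected outside [Om], a small ball around it
   would be too, against [N]. *)
assert (H1 : forall p r, P p r -> forall q, ball2 p r q -> Om (reflect v c q)).
{ intros p r HP q Hq. apply NNPP. intros Nq. destruct (Hc _ Nq) as [r' [r'0 Hr']].
  unfold ball2 in *. apply N. exists q, (Rmin r' (r - dist2 q p)). split; [apply Rmin_glb_lt; lra|].
  intros q' Hq'. assert (A1 := Rmin_l r' (r - dist2 q p)). assert (A2 := Rmin_r r' (r - dist2 q p)).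
  destruct (HP q') as [B1 B2]; [unfold ball2; generalize (dist2_triangle q' q p); lra|].
  split; [auto|split; [auto|]]. apply Hr'. rewrite dist2_reflect; [lra|auto]. }
assert (H2 : forall p r, P p r -> P (shift p v (- 2 * (c - b))) r).
{ intros p r HP q' Hq'. set (q := shift q' v (2 * (c - b))).
  assert (Hq : ball2 p r q).
  { unfold ball2 in *. replace (dist2 q p) with (dist2 q' (shift p v (- 2 * (c - b)))); [auto|].
    unfold dist2. f_equal. unfold q, shift, dot, sub; simpl. ring. }
  assert (Dq : dot q v = dot q' v + 2 * (c - b) * dot v v) by (unfold q, shift, dot; simpl; ring).
  unfold unit_vec in Hv. rewrite Hv in Dq. destruct (HP q Hq) as [_ Dq'].
  split; [|lra]. assert (E : q' = reflect v b (reflect v c q)).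
  { unfold reflect at 1. rewrite dot_reflect; [|auto]. rewrite Dq.
    unfold reflect. rewrite Dq. unfold q, shift; simpl. destruct q' as [x y]; simpl. f_equal; ring. }
  rewrite E. apply Hf; [lra|now apply (H1 p r)|]. rewrite dot_reflect; [lra|auto]. }
assert (H0 : exists p r, 0 < r /\ P p r).
{ destruct (Rlt_or_le (dot p0 v) c) as [C|C].
  - exists p0, (Rmin r0 (c - dot p0 v)). split; [apply Rmin_glb_lt; lra|]. intros q Hq. unfold ball2 in Hq.
    assert (A1 := Rmin_l r0 (c - dot p0 v)). assert (A2 := Rmin_r r0 (c - dot p0 v)).
    split; [apply Hp0; unfold ball2; lra|].
    generalize (unit_dot_le v q p0 Hv) (Rle_abs (dot q v - dot p0 v)). lra.
  (* If [p0] is on or beyond the line, a ball strictly beyond it is chosen inside the given one and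
     folded back. *)
  - set (p1 := shift p0 v (r0 / 2)).
    assert (D1 : dist2 p1 p0 = r0 / 2).
    { unfold dist2. replace (dot (sub p1 p0) (sub p1 p0)) with (Rsqr (r0 / 2) * dot v v)
       by (unfold p1, shift, dot, sub, Rsqr; simpl; ring).
      unfold unit_vec in Hv. rewrite Hv, Rmult_1_r. apply sqrt_Rsqr. lra. }
    assert (D2 : dot p1 v = dot p0 v + r0 / 2).
    { replace (dot p1 v) with (dot p0 v + r0 / 2 * dot v v) by (unfold p1, shift, dot; simpl; ring).
      unfold unit_vec in Hv. rewrite Hv. ring. }
    exists (reflect v c p1), (r0 / 2). split; [lra|]. intros q Hq. unfold ball2 in Hq.
    rewrite <- (reflect_involutive v c q Hv), dist2_reflect in Hq; [|auto].
    assert (A := unit_dot_le v (reflect v c q) p1 Hv).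
    apply Rcomplements.Rabs_le_between in A. rewrite dot_reflect in A; [|auto].
    split; [|lra]. rewrite <- (reflect_involutive v c q Hv). apply Hf; [lra| |rewrite dot_reflect; [lra|auto]].
    apply Hp0. unfold ball2. generalize (dist2_triangle (reflect v c q) p1 p0). lra. }
destruct H0 as [p [r [r1 HP]]].
assert (H3 : forall k, P (shift p v (- 2 * (c - b) * INR k)) r).
{ induction k as [|k IH].
  - replace (shift p v _) with p; [auto|]. unfold shift; destruct p; simpl. f_equal; ring.
  - rewrite S_INR. apply H2 in IH. match type of IH with P ?a r => match goal with |- P ?b r => replace b with a; [auto|] end end.
    unfold shift; simpl. f_equal; ring. }
(* Enough translations carry the centre out of the bounded set [Om]. *)
destruct (bounded_in_box Om Hb) as [M [M0 HM]].
destruct (INR_unbounded ((dot p v + 2 * M) / (2 * (c - b)))) as [k Hk].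
destruct (H3 k (shift p v (- 2 * (c - b) * INR k))) as [Ok _].
{ unfold ball2, dist2. replace (dot _ _) with 0; [rewrite sqrt_0; auto|]. unfold dot, sub; simpl. ring. }
assert (B := in_box_dot M Om v _ Hv HM Ok).
replace (dot (shift p v (- 2 * (c - b) * INR k)) v) with (dot p v + - 2 * (c - b) * INR k * dot v v) in B
 by (unfold shift, dot; simpl; ring).
unfold unit_vec in Hv. rewrite Hv in B. apply Rcomplements.Rabs_le_between in B.
apply Rmult_lt_compat_r with (r := 2 * (c - b)) in Hk; [|lra].
replace ((dot p v + 2 * M) / (2 * (c - b)) * (2 * (c - b))) with (dot p v + 2 * M) in Hk by (field; lra). lra.
Qed.

(** * The kernel as a function of the distance *)

Definition kernel (h r : R) : R := h / (sqrt (r * r + h * h)) ^ 3.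

Lemma sqrt_ge_h h r : 0 < h -> h <= sqrt (r * r + h * h).
Proof.
intros Hh. rewrite <- (sqrt_Rsqr h) at 1 by lra. apply sqrt_le_1_alt. unfold Rsqr. nra.
Qed.

Lemma Rpower_3_2 q : 0 < q -> Rpower q (3 / 2) = sqrt q ^ 3.
Proof.
intros Hq. rewrite <- Rpower_sqrt by auto.
rewrite <- Rpower_pow by apply exp_pos. rewrite Rpower_mult. f_equal. simpl. field.
Qed.

Lemma kernel_dist2 h x y : 0 < h ->
  h / Rpower (dot (sub y x) (sub y x) + h ^ 2) (3 / 2) = kernel h (dist2 y x).
Proof.
intros Hh. rewrite Rpower_3_2.
- unfold kernel. rewrite dist2_sq. do 4 f_equal. ring.
- generalize (dot_ge0 (sub y x)). nra.
Qed.

Lemma kernel_gt0 h r : 0 < h -> 0 < kernel h r.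
Proof.
intros Hh. apply Rdiv_lt_0_compat; [auto|]. apply pow_lt. generalize (sqrt_ge_h h r Hh). lra.
Qed.

Lemma kernel_lt h r s : 0 < h -> 0 <= r < s -> kernel h s < kernel h r.
Proof.
intros Hh Hr. unfold kernel, Rdiv. apply Rmult_lt_compat_l; [auto|].
assert (A := sqrt_ge_h h r Hh). assert (B : sqrt (r * r + h * h) < sqrt (s * s + h * h)).
{ apply sqrt_lt_1_alt. split; nra. }
apply Rinv_lt_contravar.
- apply Rmult_lt_0_compat; apply pow_lt; lra.
- set (a := sqrt (r * r + h * h)) in *. set (b := sqrt (s * s + h * h)) in *.
  simpl. assert (a * a < b * b) by nra. rewrite !Rmult_1_r. apply Rmult_gt_0_lt_compat; nra.
Qed.

Lemma kernel_le h r s : 0 < h -> 0 <= r <= s -> kernel h s <= kernel h r.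
Proof.
intros Hh [H1 [H2| ->]]; [|lra]. apply Rlt_le, kernel_lt; auto.
Qed.

(** The kernel is [h u^3] with [u = 1 / sqrt (r^2 + h^2) <= 1 / h]. The square root is 1-Lipschitz
    in [r], and the difference of the cubes is factored. *)
Lemma kernel_lip h r s : 0 < h -> 0 <= r -> 0 <= s ->
  Rabs (kernel h r - kernel h s) <= 3 * h * (/ h) ^ 4 * Rabs (r - s).
Proof.
intros Hh Hr Hs. unfold kernel, Rdiv. rewrite <- !pow_inv.
assert (A := sqrt_ge_h h r Hh). assert (B := sqrt_ge_h h s Hh).
assert (A2 := sqrt_sqrt (r * r + h * h)). assert (B2 := sqrt_sqrt (s * s + h * h)).
assert (A3 : r <= sqrt (r * r + h * h)). { rewrite <- (sqrt_square r) at 1 by auto. apply sqrt_le_1_alt. nra. }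
assert (B3 : s <= sqrt (s * s + h * h)). { rewrite <- (sqrt_square s) at 1 by auto. apply sqrt_le_1_alt. nra. }
set (a := sqrt (r * r + h * h)) in *. set (b := sqrt (s * s + h * h)) in *.
specialize (A2 ltac:(nra)). specialize (B2 ltac:(nra)).
assert (D : Rabs (a - b) <= Rabs (r - s)).
{ apply (Rmult_le_reg_r (a + b)); [lra|].
  rewrite <- (Rabs_pos_eq (a + b)) at 1 by lra. rewrite <- Rabs_mult.
  replace ((a - b) * (a + b)) with ((r - s) * (r + s)) by lra.
  rewrite Rabs_mult. apply Rmult_le_compat_l; [apply Rabs_pos|]. rewrite Rabs_pos_eq; lra. }
set (u := / a). set (w := / b). set (k := / h).
assert (u0 : 0 < u) by (apply Rinv_0_lt_compat; lra).
assert (w0 : 0 < w) by (apply Rinv_0_lt_compat; lra).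
assert (k0 : 0 < k) by (apply Rinv_0_lt_compat; lra).
assert (u1 : u <= k) by (apply Rinv_le_contravar; lra).
assert (w1 : w <= k) by (apply Rinv_le_contravar; lra).
replace (h * u ^ 3 - h * w ^ 3) with (h * ((b - a) * (u * w) * (u * u + u * w + w * w))).
2:{ unfold u, w. field. lra. }
rewrite !Rabs_mult, (Rabs_pos_eq h), (Rabs_pos_eq u), (Rabs_pos_eq w) by lra.
rewrite (Rabs_minus_sym b a).
assert (uw : u * w <= k * k) by nra. assert (uw0 : 0 <= u * w) by nra.
assert (S3 : Rabs (u * u + u * w + w * w) <= 3 * (k * k)) by (rewrite Rabs_pos_eq; nra).
replace (3 * h * k ^ 4 * Rabs (r - s)) with (h * (Rabs (r - s) * (k * k) * (3 * (k * k)))) by ring.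
apply Rmult_le_compat_l; [lra|]. apply Rmult_le_compat; auto using Rabs_pos.
- apply Rmult_le_pos; auto using Rabs_pos.
- apply Rmult_le_compat; auto using Rabs_pos.
Qed.

Lemma dist2_lip p q x : Rabs (dist2 p x - dist2 q x) <= l1dist p q.
Proof.
eapply Rle_trans; [|apply dist2_le_l1dist].
generalize (dist2_triangle p q x) (dist2_triangle q p x). rewrite (dist2_sym q p). intros.
apply Rabs_le. lra.
Qed.

Definition klip (h : R) : R := 3 * h * (/ h) ^ 4.

Lemma klip_ge0 h : 0 < h -> 0 <= klip h.
Proof. intros Hh. unfold klip. apply Rlt_le, Rmult_lt_0_compat; [lra|]. apply pow_lt, Rinv_0_lt_compat, Hh. Qed.

Lemma kernel_dist2_lip h x : 0 < h -> lip (klip h) (fun y => kernel h (dist2 y x)).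
Proof.
intros Hh p q. eapply Rle_trans; [apply kernel_lip; auto using dist2_ge0|].
apply Rmult_le_compat_l; [now apply klip_ge0|apply dist2_lip].
Qed.

Lemma kernel_nnlip h x : 0 < h -> nnlip (fun y => kernel h (dist2 y x)).
Proof.
intros Hh. split; [intros; now apply Rlt_le, kernel_gt0|].
exists (klip h). split; [now apply klip_ge0|now apply kernel_dist2_lip].
Qed.

Lemma nnlip_const c : 0 <= c -> nnlip (fun _ => c).
Proof.
intros Hc. split; [auto|]. exists 0. split; [lra|]. intros p q. rewrite Rminus_diag, Rabs_R0. lra.
Qed.

Lemma nnlip_pos_part f g : nnlip f -> nnlip g -> nnlip (fun p => Rmax 0 (f p - g p)).
Proof.
intros [_ [L [L0 HL]]] [_ [L' [L0' HL']]]. split; [intros; apply Rmax_l|].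
exists (L + L'). split; [lra|]. intros p q. eapply Rle_trans; [apply Rmax0_lip|].
specialize (HL p q). specialize (HL' p q).
replace (f p - g p - (f q - g q)) with ((f p - f q) + - (g p - g q)) by ring.
eapply Rle_trans; [apply Rabs_triang|]. rewrite Rabs_Ropp. lra.
Qed.

Lemma solid_angle_kernel Om h x M : 0 < M -> in_box M Om -> 0 < h ->
  solid_angle Om h x = integral_over Om (fun y => kernel h (dist2 y x)).
Proof.
intros HM HO Hh. assert (H := kernel_nnlip h x Hh).
apply (integral_ext Om _ _ M HM HO); auto using kernel_dist2.
destruct H as [H1 [L [L0 H2]]]. split.
- intros y. rewrite kernel_dist2; auto.
- exists L. split; [auto|]. intros p q. rewrite !kernel_dist2; auto.
Qed.

(** * Maximizers lie in the minimal unfolded region *)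

Lemma center_le_foldable Om h x v b : compact2 Om -> (exists p, interior2 Om p) -> 0 < h ->
  solid_angle_center Om h x -> unit_vec v -> foldable Om v b -> dot x v <= b.
Proof.
intros [Hc Hb] Hi Hh Hx Hv Hf. apply Rnot_lt_le. intros N.
set (c := (b + dot x v) / 2). set (x' := reflect v c x).
destruct (asymmetric_ball Om v b c Hc Hb Hi Hv Hf) as [p0 [r [r0 Hp0]]]; [unfold c; lra|].
destruct (bounded_in_box Om Hb) as [M0 [M00 HM0]].
set (IOm := fun q => Om (reflect v c q)).
(* Large enough for the mirror image too: reflecting moves a coordinate by at most
   [2 (2 M0 + |c|)]. *)
set (M := 5 * M0 + 2 * Rabs c).
assert (HM : 0 < M) by (unfold M; generalize (Rabs_pos c); lra).
assert (HO : in_box M Om) by (apply (in_box_mono M0); [unfold M; generalize (Rabs_pos c); lra|auto]).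
assert (HI : in_box M IOm).
{ intros q Hq. unfold IOm in Hq. assert (D := in_box_dot M0 Om v _ Hv HM0 Hq).
  destruct (HM0 _ Hq) as [A B]. assert (Ez := reflect_involutive v c q Hv).
  set (z := reflect v c q) in *. clearbody z. rewrite <- Ez. unfold reflect; simpl.
  assert (W : Rabs (dot z v - c) <= 2 * M0 + Rabs c).
  { unfold Rminus. eapply Rle_trans; [apply Rabs_triang|]. rewrite Rabs_Ropp. lra. }
  assert (V : Rabs (fst v) <= 1 /\ Rabs (snd v) <= 1).
  { unfold unit_vec, dot in Hv. split; apply Rabs_le; nra. }
  assert (G : forall t, Rabs t <= 1 -> Rabs ((dot z v - c) * t) <= 2 * M0 + Rabs c).
  { intros t Ht. rewrite Rabs_mult. generalize (Rabs_pos t) (Rabs_pos (dot z v - c)). nra. }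
  assert (G1 := G _ (proj1 V)). assert (G2 := G _ (proj2 V)).
  apply Rcomplements.Rabs_le_between in G1. apply Rcomplements.Rabs_le_between in G2.
  unfold M. lra. }
set (k := fun q => kernel h (dist2 q x)). set (k' := fun q => kernel h (dist2 q x')).
(* The gain and the loss in moving from [x] to [x']. They are mirror images of each other, so the
   loss over [Om] becomes the gain over the mirror image [IOm]. *)
set (pp := fun q => Rmax 0 (k' q - k q)). set (pm := fun q => Rmax 0 (k q - k' q)).
assert (nk : nnlip k) by now apply kernel_nnlip. assert (nk' : nnlip k') by now apply kernel_nnlip.
assert (npp : nnlip pp) by now apply nnlip_pos_part. assert (npm : nnlip pm) by now apply nnlip_pos_part.
assert (near : forall q, dot q v < c -> k q < k' q).
{ intros q Hq. apply kernel_lt; [auto|]. split; [apply dist2_ge0|]. apply dist2_reflect_lt; auto. unfold c; lra. }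
assert (sym : forall q, k (reflect v c q) = k' q).
{ intros q. unfold k, k', x'. rewrite <- (dist2_reflect v c q), reflect_involutive; auto. }
assert (sym' : forall q, k' (reflect v c q) = k q).
{ intros q. rewrite <- sym, reflect_involutive; auto. }
assert (E : solid_angle Om h x' + integral_over Om pm = solid_angle Om h x + integral_over Om pp).
{ rewrite !(solid_angle_kernel Om h _ M); auto. rewrite <- !(integral_plus Om _ _ M); auto.
  apply (integral_ext Om _ _ M); auto using nnlip_plus.
  intros q _. fold (k q) (k' q). unfold pp, pm, Rmax. repeat destruct Rle_dec; lra. }
assert (L1 : integral_over Om pm <= integral_over IOm pp).
{ apply (integral_mono_map (reflect v c) IOm Om _ _ M); auto using area_contracting_reflect.
  intros q Hq _. exists (reflect v c q). unfold IOm. rewrite !reflect_involutive; auto.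
  split; [auto|split; [auto|]]. unfold pp, pm. rewrite sym, sym'. lra. }
(* The gain is positive only on the near side of the line, where folding puts [IOm] inside [Om]; the
   ball around [p0] lies in [Om] but misses [IOm]. *)
assert (L2 : integral_over IOm pp < integral_over Om pp).
{ apply (integral_lt Om IOm pp pp (fun _ => 0) M p0 r); auto using nnlip_const, Rle_refl.
  - intros q Hq. apply Hp0. unfold ball2. generalize (dist2_le_l1dist q p0). lra.
  - intros q Hq Pq. split; [|lra].
    destruct (Rlt_or_le (dot q v) c) as [C|C].
    + rewrite <- (reflect_involutive v c q Hv). apply Hf; [unfold c; lra|auto|].
      rewrite dot_reflect; [lra|auto].
    + exfalso. assert (k' q <= k q); [|unfold pp, Rmax in Pq; destruct Rle_dec; lra].
      rewrite <- sym, <- (sym' q). destruct C as [C|C].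
      * apply Rlt_le, near. rewrite dot_reflect; [lra|auto].
      * rewrite sym, sym'. assert (reflect v c q = q).
        { unfold reflect. rewrite <- C. destruct q; simpl. f_equal; ring. }
        rewrite <- sym, H. lra.
  - intros q Hq Hd. destruct (Hp0 q) as [_ [_ Nq]]; [|easy]. unfold ball2. generalize (dist2_le_l1dist q p0). lra.
  - destruct (Hp0 p0) as [_ [A _]].
    { unfold ball2. eapply Rle_lt_trans; [apply dist2_le_l1dist|]. now rewrite l1dist_refl. }
    apply near in A. unfold pp, Rmax. destruct Rle_dec; lra. }
specialize (Hx x'). lra.
Qed.

Lemma reflect_opp v c z : reflect (- fst v, - snd v) (- c) z = reflect v c z.
Proof. unfold reflect, dot; simpl. f_equal; ring. Qed.

(** The bound by [lval] is the folding bound for [- v]. The sets of levels are nonempty and bounded,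
    so [Rinf] and [Rsup] are a true infimum and supremum. *)
Lemma center_in_uf Om h x : compact2 Om -> (exists p, interior2 Om p) -> 0 < h ->
  solid_angle_center Om h x -> uf Om x.
Proof.
intros HO [p Hp] Hh Hx v Hv.
destruct (bounded_in_box Om (proj2 HO)) as [M [M0 HM]].
assert (Op : Om p).
{ destruct Hp as [r [r0 Hr]]. apply Hr. unfold ball2. eapply Rle_lt_trans; [apply dist2_le_l1dist|]. now rewrite l1dist_refl. }
assert (Hd : forall w z, unit_vec w -> Om z -> - (2 * M) <= dot z w <= 2 * M).
{ intros w z Hw Oz. apply Rcomplements.Rabs_le_between. now apply (in_box_dot M Om). }
assert (Hv' : unit_vec (- fst v, - snd v)) by (unfold unit_vec, dot in *; simpl; lra).
(* Folding at a level below [- 2 M] would send [p] out of the strip that contains [Om]. *)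
assert (low : forall w b, unit_vec w -> foldable Om w b -> - (2 * M) <= b).
{ intros w b Hw Hb. apply Rnot_lt_le. intros N. assert (D := Hd w p Hw Op).
  assert (D' := Hd w _ Hw (Hb b (Rge_refl b) p Op ltac:(lra))). rewrite dot_reflect in D'; [lra|auto]. }
assert (fo : forall b, (forall c, c <= b -> forall z, Om z -> dot z v <= c -> Om (reflect v c z)) ->
   foldable Om (- fst v, - snd v) (- b)).
{ intros b Hb c Hc z Oz Dz. rewrite <- (Ropp_involutive c), reflect_opp. apply Hb; [lra|auto|].
  unfold dot in *; simpl in Dz. lra. }
split.
- destruct (Rsup_lub (fun b => forall c, c <= b -> forall z, Om z -> dot z v <= c -> Om (reflect v c z))) as [_ G].
  + exists (- (2 * M) - 1). intros c Hc z Oz Dz. generalize (Hd v z Hv Oz). lra.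
  + exists (2 * M). intros b Hb. generalize (low _ _ Hv' (fo b Hb)). lra.
  + apply G. intros b Hb.
    assert (D := center_le_foldable Om h x _ _ HO (ex_intro _ p Hp) Hh Hx Hv' (fo b Hb)).
    unfold dot in *; simpl in D. lra.
- destruct (Rinf_glb (foldable Om v)) as [_ G].
  + exists (2 * M + 1). intros c Hc z Oz Dz. generalize (Hd v z Hv Oz). lra.
  + exists (- (2 * M)). intros b Hb. now apply (low v).
  + apply G. intros b Hb. now apply (center_le_foldable Om h x v b HO (ex_intro _ p Hp)).
Qed.

(** * Existence and uniqueness of the maximizer *)

Lemma lip_continuity_pt f C x : (forall s t, f s <= f t + C * Rabs (s - t)) -> continuity_pt f x.
Proof.
intros H e He. assert (K : 0 < Rabs C + 1) by (generalize (Rabs_pos C); lra).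
exists (e / (Rabs C + 1)). split; [now apply Rdiv_lt_0_compat|].
intros y [_ Hy]. simpl in *. unfold R_dist in *.
assert (A := H x y). assert (B := H y x). rewrite (Rabs_minus_sym x y) in A.
assert (P := Rabs_pos (y - x)). assert (Q := Rle_abs C).
apply Rmult_lt_compat_r with (r := Rabs C + 1) in Hy; [|auto].
replace (e / (Rabs C + 1) * (Rabs C + 1)) with e in Hy by (field; lra).
apply Rabs_def1; nra.
Qed.

(** The one-variable extreme value theorem is applied twice: [Y s] maximizes [F s], and the partial
    maximum [F s (Y s)] is again Lipschitz in [s]. *)
Lemma box_max (F : R -> R -> R) C M : 0 <= M ->
  (forall s t s' t', F s t <= F s' t' + C * (Rabs (s - s') + Rabs (t - t'))) ->
  exists x y, forall s t, - M <= s <= M -> - M <= t <= M -> F s t <= F x y.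
Proof.
intros HM HF.
assert (Hy : forall s, exists y, - M <= y <= M /\ forall t, - M <= t <= M -> F s t <= F s y).
{ intros s. destruct (continuity_ab_maj (F s) (- M) M) as [y [Y1 Y2]]; [lra| |exists y; auto].
  intros c _. apply (lip_continuity_pt _ C). intros t t'. generalize (HF s t s t').
  rewrite Rminus_diag, Rabs_R0, Rplus_0_l. auto. }
set (Y := fun s => proj1_sig (constructive_indefinite_description _ (Hy s))).
assert (HY : forall s, - M <= Y s <= M /\ forall t, - M <= t <= M -> F s t <= F s (Y s)).
{ intros s. unfold Y. apply (proj2_sig (constructive_indefinite_description _ (Hy s))). }
destruct (continuity_ab_maj (fun s => F s (Y s)) (- M) M) as [x [X1 X2]]; [lra| |].
- intros c _. apply (lip_continuity_pt _ C). intros s s'.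
  generalize (HF s (Y s) s' (Y s)) (proj2 (HY s') (Y s) (proj1 (HY s))).
  rewrite (Rminus_diag (Y s)), Rabs_R0, Rplus_0_r. lra.
- exists x, (Y x). intros s t Hs Ht. eapply Rle_trans; [apply HY; auto|]. now apply X1.
Qed.

(** The kernel changes by at most [klip h * l1dist x x'] at each point, and the box has area
    [4 M^2]. *)
Lemma solid_angle_lip Om h M x x' : 0 < M -> in_box M Om -> 0 < h ->
  solid_angle Om h x <= solid_angle Om h x' + 4 * M * M * klip h * l1dist x x'.
Proof.
intros HM HO Hh. rewrite !(solid_angle_kernel Om h _ M); auto.
set (c := klip h * l1dist x x').
assert (c0 : 0 <= c) by (apply Rmult_le_pos; [now apply klip_ge0|apply l1dist_ge0]).
assert (B : integral_over Om (fun _ => c) <= 4 * M * M * c).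
{ replace (4 * M * M * c) with (upper_sum [(mkRect (-M) M (-M) M, c)]) by (unfold upper_sum, area; simpl; ring).
  apply (integral_le_cover Om _ M); auto using nnlip_const. split.
  - intros rc [<-|[]]. unfold rect_ok; simpl; lra.
  - intros p Hp. eexists. split; [now left|]. split; [exact (HO p Hp)|simpl; lra]. }
apply Rle_trans with (integral_over Om (fun y => kernel h (dist2 y x') + c)).
- apply (integral_mono Om Om _ _ M); auto using kernel_nnlip, nnlip_plus, nnlip_const.
  intros q Hq _. split; [auto|]. generalize (kernel_dist2_lip h q Hh x x'). fold c.
  rewrite (dist2_sym x), (dist2_sym x'). intros A. apply Rcomplements.Rabs_le_between in A. lra.
- rewrite (integral_plus Om _ _ M); auto using kernel_nnlip, nnlip_const. unfold c in *. lra.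
Qed.

(* Clamping the coordinates of a point to a box containing [Om] brings it closer to all
   points of [Om], so it suffices to maximize over the box. *)
Lemma solid_angle_center_exists Om h : bounded Om -> 0 < h -> exists x, solid_angle_center Om h x.
Proof.
intros Hb Hh. destruct (bounded_in_box Om Hb) as [M [HM HO]].
destruct (box_max (fun s t => solid_angle Om h (s, t)) (4 * M * M * klip h) M) as [x [y H]]; [lra| |].
{ intros s t s' t'. apply (solid_angle_lip Om h M (s, t) (s', t')); auto. }
exists (x, y). intros [s t].
apply Rle_trans with (solid_angle Om h (clamp (- M) M s, clamp (- M) M t)).
- rewrite !(solid_angle_kernel Om h _ M); auto.
  apply (integral_mono Om Om _ _ M); auto using kernel_nnlip.
  intros q Hq _. split; [auto|]. apply kernel_le; [auto|]. split; [apply dist2_ge0|].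
  destruct (HO q Hq) as [A B]. apply sqrt_le_1_alt. unfold dot, sub; simpl.
  assert (G : forall u w, - M <= u <= M -> (u - clamp (- M) M w) * (u - clamp (- M) M w) <= (u - w) * (u - w)).
  { intros u w Hu. unfold clamp, Rmax, Rmin. repeat destruct Rle_dec; nra. }
  apply Rplus_le_compat; auto.
- apply H; apply clamp_bounds; lra.
Qed.

(** * Strict concavity of the kernel *)

Lemma kernel_derive h r : 0 < h ->
  is_derive (kernel h) r (- 3 * h * r / sqrt (r * r + h * h) ^ 5).
Proof.
intros Hh. assert (A := sqrt_ge_h h r Hh). assert (Q : 0 < r * r + h * h) by nra.
unfold kernel. auto_derive.
- repeat split; auto. apply (pow_nonzero _ 3). lra.
- assert (S2 := sqrt_sqrt (r * r + h * h) ltac:(lra)).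
  set (a := sqrt (r * r + h * h)) in *. field. lra.
Qed.

(** The factor [4 r^2 - h^2] is negative for [0 <= r < h / 2]; this is the source of the factor 2 in
    the theorem. *)
Lemma kernel_derive2 h r : 0 < h ->
  is_derive (fun r => - 3 * h * r / sqrt (r * r + h * h) ^ 5) r
    (3 * h * (4 * (r * r) - h * h) / sqrt (r * r + h * h) ^ 7).
Proof.
intros Hh. assert (A := sqrt_ge_h h r Hh). assert (Q : 0 < r * r + h * h) by nra.
auto_derive.
- repeat split; auto. apply (pow_nonzero _ 5). lra.
- assert (S2 := sqrt_sqrt (r * r + h * h) ltac:(lra)).
  set (a := sqrt (r * r + h * h)) in *. assert (E : h * h = a * a - r * r) by lra.
  replace (4 * (r * r) - h * h) with (5 * (r * r) - a * a) by lra. field. lra.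
Qed.

Lemma kernel_strict_concave h r s : 0 < h -> 0 <= r -> r < s -> 2 * s <= h ->
  kernel h r + kernel h s < 2 * kernel h ((r + s) / 2).
Proof.
intros Hh Hr Hrs Hs. set (m := (r + s) / 2).
set (k' := fun r => - 3 * h * r / sqrt (r * r + h * h) ^ 5).
assert (D : forall c, derivable_pt_lim (kernel h) c (k' c)).
{ intros c. apply is_derive_Reals. now apply kernel_derive. }
destruct (MVT_cor2 (kernel h) k' r m) as [c1 [E1 C1]]; [unfold m; lra|auto|].
destruct (MVT_cor2 (kernel h) k' m s) as [c2 [E2 C2]]; [unfold m; lra|auto|].
(* As [c3 < c2 < s], the second derivative is strictly negative at [c3] even when [2 s = h]. *)
destruct (MVT_cor2 k' (fun r => 3 * h * (4 * (r * r) - h * h) / sqrt (r * r + h * h) ^ 7) c1 c2) as [c3 [E3 C3]].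
{ lra. } { intros c _. apply is_derive_Reals. now apply kernel_derive2. }
assert (N : 3 * h * (4 * (c3 * c3) - h * h) / sqrt (c3 * c3 + h * h) ^ 7 < 0).
{ assert (P : 0 < / sqrt (c3 * c3 + h * h) ^ 7).
  { apply Rinv_0_lt_compat, pow_lt. generalize (sqrt_ge_h h c3 Hh). lra. }
  assert (Q : 4 * (c3 * c3) - h * h < 0) by nra.
  unfold Rdiv. assert (3 * h * (4 * (c3 * c3) - h * h) < 0) by nra. nra. }
assert (k' c2 < k' c1) by nra.
assert (E : s - m = m - r) by (unfold m; field). rewrite E in E2.
assert (0 < m - r) by (unfold m; lra). nra.
Qed.

Definition midpoint (x y : pt) : pt := ((fst x + fst y) / 2, (snd x + snd y) / 2).

(** If the distances from [y] differ, strict concavity applies, since the distance to the midpoint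
    is at most their mean. If they agree, the parallelogram law makes the midpoint strictly
    closer. *)
Lemma kernel_midpoint_lt h x1 x2 y : 0 < h -> x1 <> x2 ->
  2 * dist2 y x1 <= h -> 2 * dist2 y x2 <= h ->
  kernel h (dist2 y x1) + kernel h (dist2 y x2) < 2 * kernel h (dist2 y (midpoint x1 x2)).
Proof.
intros Hh Hx H1 H2. set (m := midpoint x1 x2).
assert (P1 := dist2_ge0 y x1). assert (P2 := dist2_ge0 y x2). assert (Pm := dist2_ge0 y m).
assert (Q1 := dist2_sq y x1). assert (Q2 := dist2_sq y x2). assert (Qm := dist2_sq y m).
assert (par : 4 * dot (sub y m) (sub y m) + dot (sub x1 x2) (sub x1 x2) =
  2 * dot (sub y x1) (sub y x1) + 2 * dot (sub y x2) (sub y x2)).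
{ unfold m, midpoint, dot, sub; simpl. field. }
assert (dx : 0 < dot (sub x1 x2) (sub x1 x2)).
{ destruct (Rle_lt_or_eq_dec _ _ (dot_ge0 (sub x1 x2))) as [|E]; [auto|]. exfalso. apply Hx.
  unfold dot, sub in E; simpl in E. symmetry in E. apply Rplus_sqr_eq_0 in E.
  destruct x1, x2; simpl in *. f_equal; lra. }
assert (tri : 2 * dist2 y m <= dist2 y x1 + dist2 y x2).
{ assert (T := dist2_triangle x1 y x2). rewrite (dist2_sym x1 y) in T.
  assert (T1 := dist2_triangle y x1 x2). assert (T2 := dist2_triangle y x2 x1).
  rewrite (dist2_sym x2 x1) in T2. assert (QX := dist2_sq x1 x2).
  rewrite (dist2_sym y x1) in *. set (a := dist2 x1 y) in *. set (b := dist2 y x2) in *. set (d := dist2 x1 x2) in *.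
  (* With [d^2 >= (a - b)^2] the parallelogram law gives that four times the squared median is at
     most [(a + b)^2]. *)
  assert (0 <= (d - (a - b)) * (d + (a - b))) by (apply Rmult_le_pos; lra).
  apply Rsqr_incr_0_var; [unfold Rsqr|]; lra. }
rewrite <- Q1, <- Q2, <- Qm in par.
destruct (Rtotal_order (dist2 y x1) (dist2 y x2)) as [L|[E|L]].
- assert (C := kernel_strict_concave h _ _ Hh P1 L H2).
  assert (K := kernel_le h (dist2 y m) ((dist2 y x1 + dist2 y x2) / 2) Hh). lra.
- rewrite <- E in *. assert (K := kernel_lt h (dist2 y m) (dist2 y x1) Hh). nra.
- assert (C := kernel_strict_concave h _ _ Hh P2 L H1).
  rewrite (Rplus_comm (dist2 y x2)) in C.
  assert (K := kernel_le h (dist2 y m) ((dist2 y x1 + dist2 y x2) / 2) Hh). lra.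
Qed.

(* Leave [Om] along the ray from [y] pointing away from [x]. *)
Lemma farther_boundary_point Om x y : bounded Om -> Om y ->
  exists w, boundary2 Om w /\ dist2 y x <= dist2 w x.
Proof.
intros Hb Hy. destruct (bounded_in_box Om Hb) as [M [HM HO]].
(* Along any such direction the distance from [x] does not decrease; a horizontal one always exists,
   also when [y = x]. *)
assert (Hu : exists u, unit_vec u /\ 0 <= dot (sub y x) u).
{ destruct (Rle_lt_dec (fst y - fst x) 0) as [H|H].
  - exists (-1, 0). unfold unit_vec, dot, sub; simpl. lra.
  - exists (1, 0). unfold unit_vec, dot, sub; simpl. lra. }
destruct Hu as [u [Hu Hxu]].
set (E := fun t => Om (shift y u t)).
assert (E0 : E 0). { unfold E, shift. destruct y; simpl. now rewrite !Rmult_0_l, !Rplus_0_r. }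
assert (Du : forall s t, dist2 (shift y u s) (shift y u t) = Rabs (s - t)).
{ intros s t. unfold dist2. rewrite <- sqrt_Rsqr_abs. f_equal.
  replace (dot (sub (shift y u s) (shift y u t)) (sub (shift y u s) (shift y u t))) with
    ((s - t) * (s - t) * dot u u) by (unfold shift, dot, sub; simpl; ring).
  rewrite Hu. unfold Rsqr. ring. }
destruct (completeness E) as [t [T1 T2]].
- exists (4 * M). intros s Hs. assert (A := in_box_dot M Om u _ Hu HO Hs). assert (B := in_box_dot M Om u _ Hu HO Hy).
  replace (dot (shift y u s) u) with (dot y u + s * dot u u) in A by (unfold shift, dot; simpl; ring).
  rewrite Hu in A. apply Rcomplements.Rabs_le_between in A. apply Rcomplements.Rabs_le_between in B. lra.
- now exists 0.
(* The last parameter [t] gives a boundary point: [Om] is met arbitrarily close to it, but not at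
   any larger parameter. *)
- assert (t0 := T1 0 E0).
  exists (shift y u t). split; [split|].
  + intros r Hr. apply NNPP. intros N. enough (t <= t - r) by lra. apply T2. intros s Hs.
    apply Rnot_lt_le. intros Hst. apply N. exists (shift y u s). split; [|exact Hs].
    unfold ball2. rewrite Du. assert (S1 := T1 s Hs). apply Rabs_def1; lra.
  + intros [r [Hr H]]. assert (Et : E (t + r / 2)).
    { apply H. unfold ball2. rewrite Du. apply Rabs_def1; lra. }
    apply T1 in Et. lra.
  + apply sqrt_le_1_alt.
    replace (dot (sub (shift y u t) x) (sub (shift y u t) x)) with
     (dot (sub y x) (sub y x) + 2 * (t * dot (sub y x) u) + t * t * dot u u)
      by (unfold shift, dot, sub; simpl; ring).
    rewrite Hu. assert (0 <= t * dot (sub y x) u) by now apply Rmult_le_pos. nra.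
Qed.

Theorem theorem4p5 (Om : pt -> Prop) (h : R) :
  compact2 Om ->
  (exists p, interior2 Om p) ->
  0 < h ->
  (forall z w, uf Om z -> boundary2 Om w -> 2 * dist2 z w <= h) ->
  exists! x, solid_angle_center Om h x.
Proof.
intros HO Hi Hh Huf. assert (Hb := proj2 HO).
destruct (solid_angle_center_exists Om h Hb Hh) as [x Hx]. exists x. split; [exact Hx|].
assert (near : forall z y, solid_angle_center Om h z -> Om y -> 2 * dist2 y z <= h).
{ intros z y Hz Hy. destruct (farther_boundary_point Om z y Hb Hy) as [w [W1 W2]].
  generalize (Huf z w (center_in_uf Om h z HO Hi Hh Hz) W1). rewrite (dist2_sym z w). lra. }
intros x' Hx'. apply NNPP. intros N. set (m := midpoint x x').
destruct (bounded_in_box Om Hb) as [M [HM HB]].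
assert (lt : forall y, Om y -> kernel h (dist2 y x) + kernel h (dist2 y x') < kernel h (dist2 y m) + kernel h (dist2 y m)).
{ intros y Hy. generalize (kernel_midpoint_lt h x x' y Hh N (near x y Hx Hy) (near x' y Hx' Hy)). fold m. lra. }
destruct Hi as [p [r [Hr Hp]]].
assert (Hp' : forall q, l1dist q p < r -> Om q).
{ intros q Hq. apply Hp. unfold ball2. generalize (dist2_le_l1dist q p). lra. }
(* The pointwise inequality is strict on all of [Om], and a ball in [Om] makes the integrated one
   strict; then [m] beats one of the two maximizers. *)
assert (I : solid_angle Om h x + solid_angle Om h x' < solid_angle Om h m + solid_angle Om h m).
{ rewrite !(solid_angle_kernel Om h _ M); auto. rewrite <- !(integral_plus Om _ _ M); auto using kernel_nnlip.
  apply (integral_lt Om Om _ _ (fun y => kernel h (dist2 y x) + kernel h (dist2 y x')) M p r);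
    auto using nnlip_plus, kernel_nnlip, Rle_refl.
  - intros q Hq _. split; [auto|]. now apply Rlt_le, lt.
  - apply lt, Hp'. now rewrite l1dist_refl. }
generalize (Hx m) (Hx' m). lra.
Qed.
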